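(* Let $2\le N\le M$ and let $\mathscr{O}_{1,1}$ be the diagonal overlap associated with the eigenvalue $\lambda_1$ of a matrix distributed according to the truncated unitary ensemble $\mathrm{TUE}(N,M)$. Conditionally on the spectrum $\Lambda=(\lambda_1,\dots,\lambda_N)$ (with distinct $\lambda_i$ in the open unit disk), $$\mathscr{O}_{1,1}\ \stackrel{d}{=}\ \prod_{k=2}^N\left(1+\frac{(1-|\lambda_1|^2)(1-|\lambda_k|^2)}{|\lambda_1-\lambda_k|^2}\,Y_M^{(k)}\right),$$ where $Y_M^{(2)},\dots,Y_M^{(N)}$ are i.i.d. real random variables with density $(M-1)(1-y)^{M-2}\mathbf{1}_{(0,1)}(y)$ with respect to Lebesgue measure. In particular, $$\mathbb{E}_\Lambda(\mathscr{O}_{1,1})=\prod_{k=2}^N\left(1+\frac{(1-|\lambda_1|^2)(1-|\lambda_k|^2)}{M|\lambda_1-\lambda_k|^2}\right).$$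
   Context: $\mathrm{TUE}(N,M)$ is the law of the top-left $N\times N$ block $G$ of a Haar-distributed unitary matrix of size $N+M$; throughout $N\le M$. The spectrum is almost surely simple; the eigenvalues $\lambda_1,\dots,\lambda_N$ are labelled exchangeably (uniformly random labelling). Overlaps: for a matrix $G$ with simple spectrum, let $R_j$ be right eigenvectors (columns) and $L_j$ left eigenvectors (rows) with $GR_j=\lambda_jR_j$, $L_jG=\lambda_jL_j$, $L_iR_j=\delta_{ij}$. Then $\mathscr{O}_{i,j}=(L_iL_j^* )(R_j^*R_i)$; this does not depend on the choice of such eigenvectors and is invariant under unitary change of basis. Schur form and conditioning: $G$ can be written $G=UTU^*$ with $U$ unitary (suitably chosen at random) and $T$ upper triangular with diagonal $(\lambda_1,\dots,\lambda_N)$, such that $T$ has density proportional to $\prod_{i<j}|\lambda_i-\lambda_j|^2\det(I_N-TT^* )^{M-N}\mathbf{1}_{TT^*<1}$ with respect to Lebesgue measure on all diagonal and strictly upper-triangular complex entries ($TT^*<1$ means $I_N-TT^*$ is positive definite). The overlaps of $G$ equal those of $T$. Conditioning on $\Lambda$ means fixing the diagonal of $T$ and renormalizing this density in the strictly upper-triangular entries; $\mathbb{E}_\Lambda$ is the corresponding conditional expectation. *)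

(* Defs.v *)
From HB Require Import structures.
From mathcomp Require Import all_boot all_order all_algebra.
From mathcomp Require Import complex.
From mathcomp Require Import all_classical all_reals all_analysis.

Set Implicit Arguments.
Unset Strict Implicit.
Unset Printing Implicit Defensive.

Import Order.TTheory GRing.Theory Num.Theory.
Import numFieldNormedType.Exports.

Local Open Scope classical_set_scope.
Local Open Scope ring_scope.
Local Open Scope sesquilinear_scope.
Local Open Scope complex_scope.

(* The real-valued modulus; the norm `|z| of R[i] takes its values in R[i]. *)
Notation modc := ComplexField.Normc.normc.

Section Overlaps.
Context {R : realType} {N : nat}.
Implicit Types (G Rm Lm : 'M[R[i]]_N) (lam : 'I_N -> R[i]).

(* The columns of Rm are the right eigenvectors R_j, the rows of Lm the left
   eigenvectors L_j. *)
Definition biorthogonal_eigensystem G lam Rm Lm : Prop :=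
  [/\ forall j, G *m col j Rm = lam j *: col j Rm,
      forall j, row j Lm *m G = lam j *: row j Lm &
      Lm *m Rm = 1%:M].

(* O_(i,j) = (L_i L_j^* ) (R_j^* R_i), for a chosen eigensystem. The family lam
   is meant to list the simple spectrum of G: an eigensystem then exists and
   the value does not depend on the choice. *)
Definition overlap G lam (i j : 'I_N) : R[i] :=
  let RL := xget (0, 0)
    [set p : ('M[R[i]]_N * 'M[R[i]]_N)%type |
       biorthogonal_eigensystem G lam p.1 p.2] in
  (row i RL.2 *m (row j RL.2) ^t*) 0 0 * ((col j RL.1) ^t* *m col i RL.1) 0 0.

(* O_(i,i) is a product of two squared norms: its imaginary part vanishes. *)
Definition diag_overlap G lam (i : 'I_N) : R := complex.Re (overlap G lam i i).

End Overlaps.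

Section LebesgueTuple.
Context {R : realType}.

Definition tuple_cons n (p : n.-tuple R * R) : n.+1.-tuple R :=
  [tuple of p.2 :: p.1].

Lemma measurable_tuple_cons n :
  measurable_fun [set: n.-tuple (measurableTypeR R) * measurableTypeR R]
    (@tuple_cons n : _ -> n.+1.-tuple (measurableTypeR R)).
Proof. exact: measurable_cons. Qed.

(* Image under tuple_cons of the product of m and the Lebesgue measure. *)
Definition tuple_cons_measure n
    (m : {measure set (n.-tuple (measurableTypeR R)) -> \bar R}) :
    {measure set (n.+1.-tuple (measurableTypeR R)) -> \bar R} :=
  measure_function_pushforward__canonical__measure_function_Measure
    (m \x lebesgue_measure)%E (@measurable_tuple_cons n).

(* The Lebesgue measure on R^n. *)
Fixpoint lebesgue_tuple n :
    {measure set (n.-tuple (measurableTypeR R)) -> \bar R} :=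
  if n is n'.+1 then tuple_cons_measure (lebesgue_tuple n')
  else dirac ([tuple] : 0.-tuple (measurableTypeR R)).

End LebesgueTuple.

Section SchurForm.
Context {R : realType} {N : nat}.

Definition posdefmx (A : 'M[R[i]]_N) : Prop :=
  A ^t* = A /\ forall v : 'cV[R[i]]_N, v != 0 -> 0 < (v ^t* *m A *m v) 0 0.

(* Unnormalized density of the triangular Schur factor of TUE(N, M); the
   determinant is real where the indicator does not vanish. *)
Definition tue_schur_density (M : nat) (T : 'M[R[i]]_N) : R :=
  (\prod_(i < N) \prod_(j < N | (i < j)%N) modc (T i i - T j j) ^+ 2) *
  complex.Re (\det (1%:M - T *m T ^t*)) ^+ (M - N) *
  \1_[set S : 'M[R[i]]_N | posdefmx (1%:M - S *m S ^t*)] T.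

Definition upper_index := {p : 'I_N * 'I_N | (p.1 < p.2)%N}.

(* Real coordinates of the strictly upper-triangular part of a complex matrix:
   first the real parts of the entries, then their imaginary parts. *)
Definition upper_entries :=
  (#|{: upper_index}| + #|{: upper_index}|).-tuple (measurableTypeR R).

Definition lebesgue_upper : {measure set upper_entries -> \bar R} :=
  lebesgue_tuple _.

Definition schur_mx (lam : 'I_N -> R[i]) (x : upper_entries) : 'M[R[i]]_N :=
  \matrix_(i, j)
    if i == j then lam i
    else if insub (i, j) is Some p
         then let k := enum_rank (p : upper_index) in
              tnth x (lshift _ k) +i* tnth x (rshift _ k)
         else 0.

End SchurForm.
Arguments upper_index : clear implicits.
Arguments upper_entries : clear implicits.
Arguments lebesgue_upper : clear implicits.

Section ConditionalLaw.
Context {R : realType} {d : measure_display} {Om : measurableType d}.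
Variable P : probability Om R.

(* The law of X is the density of the Schur factor with its diagonal fixed to
   lam, renormalized: the constant c is determined by P having mass 1. *)
Definition schur_law_given (N M : nat) (lam : 'I_N -> R[i])
    (X : {RV P >-> upper_entries R N}) : Prop :=
  exists c : R, forall A : set (upper_entries R N), measurable A ->
    distribution P X A =
    (c%:E * \int[lebesgue_upper R N]_(x in A)
              (tue_schur_density M (schur_mx lam x))%:E)%E.

(* G is, on (Om, P), a TUE(N, M) matrix conditioned on its spectrum being lam;
   nothing is required of the joint law of U and X. *)
Definition tue_given_spectrum (N M : nat) (lam : 'I_N -> R[i])
    (G : Om -> 'M[R[i]]_N) : Prop :=
  exists (U : Om -> 'M[R[i]]_N) (X : {RV P >-> upper_entries R N}),
    [/\ forall w, U w \is unitarymx,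
        schur_law_given M lam X &
        forall w, G w = U w *m schur_mx lam (X w) *m (U w) ^t*].

Definition has_density (Y : {RV P >-> R}) (f : R -> R) : Prop :=
  forall A : set R, measurable A ->
    distribution P Y A = (\int[lebesgue_measure]_(y in A) (f y)%:E)%E.

(* Since A k may be the full set, this includes the product rule for every
   subfamily. *)
Definition mutually_independent (I : finType) (D : {pred I})
    (Y : I -> {RV P >-> R}) : Prop :=
  forall A : I -> set R, (forall k, measurable (A k)) ->
    P (\bigcap_(k in [set` D]) (Y k @^-1` A k)) =
    (\prod_(k in D) P (Y k @^-1` A k))%E.

End ConditionalLaw.

Definition eq_in_law (R : realType) (d1 d2 : measure_display)
    (Om1 : measurableType d1) (Om2 : measurableType d2)
    (P1 : probability Om1 R) (P2 : probability Om2 R)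
    (Z1 : Om1 -> R) (Z2 : Om2 -> R) : Prop :=
  [/\ measurable_fun setT Z1, measurable_fun setT Z2 &
      forall A : set R, measurable A ->
        P1 (Z1 @^-1` A) = P2 (Z2 @^-1` A)].

(* (m - 1) (1 - y)^(m - 2) on (0, 1), for m >= 2. *)
Definition beta1_density (R : realType) (m : nat) (y : R) : R :=
  (m - 1)%:R * (1 - y) ^+ (m - 2) * \1_(`]0, 1[%classic : set R) y.

(* Main.v *)
Require Import Defs.
From HB Require Import structures.
From mathcomp Require Import all_boot all_order all_algebra.
From mathcomp Require Import complex.
From mathcomp Require Import all_classical all_reals all_analysis.
From mathcomp Require Import measurable_realfun.
From mathcomp Require Import zify ring lra.

Set Implicit Arguments.
Unset Strict Implicit.
Unset Printing Implicit Defensive.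

Import Order.TTheory GRing.Theory Num.Theory.
Import numFieldNormedType.Exports.

Local Open Scope classical_set_scope.
Local Open Scope ring_scope.
Local Open Scope sesquilinear_scope.
Local Open Scope complex_scope.

(* Work with the triangular factor T with diagonal lam, and peel off its columns
   from the right. The row vector b with b T = lam_1 b and b_1 = 1 has b_j
   depending only on the first j columns, and the diagonal overlap is |b|^2.
   Let T' be the leading n x n block, with left eigenvector b', let u be the next
   column and nu the next eigenvalue. A Schur complement gives
     1 - T T^* > 0  iff  1 - T' T'^* - s^-1 u u^* > 0,   s = 1 - |nu|^2.
   Factor 1 - T' T'^* = B B^* so that b' B = beta (1, 0, .., 0), and substitute
   u = sqrt(s) B v: the density becomes a constant times
   det(1 - T' T'^* )^(m + 1) (1 - |v|^2)^m on the unit ball, and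
     |b|^2 = |b'|^2 + |b' u|^2 / |lam_1 - nu|^2
           = |b'|^2 (1 + (1 - |lam_1|^2) s / |lam_1 - nu|^2 * |v_1|^2),
   because |beta|^2 = b' (1 - T' T'^* ) b'^* = (1 - |lam_1|^2) |b'|^2. Integrating out
   v_2, .., v_n leaves |v_1|^2 with density proportional to (1 - y)^(m + n - 1).
   As m grows by one each time n decreases by one, the exponent is M - 2 at every
   step. The multiplicative constants are never computed: the total mass fixes
   their product. *)

(** * Iterated integrals over coordinates *)

(** Both sides of the identity in law are tested against an arbitrary measurable [f >= 0] and
    reduced to the same functional, the iterated one-dimensional integral [beta_prod]. Keeping [f]
    arbitrary closes the induction: integrating out a column replaces [f] by its average over one
    beta factor, again nonnegative and measurable, evaluated at the overlap of the smaller block.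
    Indicators then give the law, and the absolute value gives the mean directly, without a space
    that carries the variables [Y k]. The unitary factor drops out pointwise, since the overlap is
    invariant under unitary conjugation. The substitution by [B] shapes the analytic part. It is
    carried out one coordinate at a time, by scalings and translations of the real line. This is why
    integrals over entries are written as iterated integrals, and why [B] is assembled from
    triangular factors instead of a square root of the Gram matrix. *)

Lemma integral_pushforwardT d1 d2 (X : measurableType d1) (Y : measurableType d2)
    (R : realType) (phi : X -> Y) (mu : {measure set X -> \bar R}) (f : Y -> \bar R) :
  measurable_fun setT phi -> measurable_fun setT f -> (forall y, 0 <= f y)%E ->
  (\int[pushforward mu phi]_y f y = \int[mu]_x f (phi x))%E.
Proof.
move=> mphi mf f0; rewrite (ge0_integral_pushforward mphi)// preimage_setT//.
Qed.

Section Affine_change.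
Context {R : realType}.
Local Notation mu := (@lebesgue_measure R).

(** The image of Lebesgue measure under a translation agrees with it on half-open intervals, and
    these determine it. The same argument gives the scaling rule below, with the image measure
    multiplied by [k]. *)
Lemma integral_translate (h : R) (f : R -> \bar R) :
  measurable_fun setT f -> (forall x, (0 <= f x)%E) ->
  (\int[mu]_x f (x + h)%R = \int[mu]_x f x)%E.
Proof.
move=> mf f0.
have mh : measurable_fun [set: measurableTypeR R]
  ((fun x => x + h) : _ -> measurableTypeR R) by exact: measurable_funD.
rewrite -(integral_pushforwardT mu mh mf f0).
apply: eq_measure_integral => A mA _; symmetry.
pose m := measure_function_pushforward__canonical__measure_function_Measure mu mh.
apply: (lebesgue_measure_unique (mu := m)) => //.
move=> _ [[a b] _ <-] /=; rewrite /m /= /pushforward.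
rewrite (_ : _ @^-1` _ = `]a - h, b - h]%classic); last first.
  by apply/seteqP; split => x /=; rewrite !in_itv/= ltrBlDr lerBrDr.
rewrite !lebesgue_measure_itv /= !lte_fin ltrD2r.
by case: ifP => // _; rewrite -!EFinD; congr (_%:E); lra.
Qed.

Lemma integral_scale (k : R) (f : R -> \bar R) : 0 < k ->
  measurable_fun setT f -> (forall x, (0 <= f x)%E) ->
  (\int[mu]_x f x = k%:E * \int[mu]_x f (k * x)%R)%E.
Proof.
move=> k0 mf f0.
have mh : measurable_fun [set: measurableTypeR R]
  ((fun x => k * x) : _ -> measurableTypeR R) by exact: measurable_funM.
rewrite -(integral_pushforwardT mu mh mf f0).
pose m := measure_function_pushforward__canonical__measure_function_Measure mu mh.
rewrite -[k in RHS]/((NngNum (ltW k0))%:num) -(@ge0_integral_mscale _ _ _ m)//.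
apply: eq_measure_integral => A mA _.
apply: (lebesgue_measure_unique (mu := mscale (NngNum (ltW k0)) m)) => //.
move=> _ [[a b] _ <-] /=; rewrite /mscale /= /pushforward.
rewrite (_ : _ @^-1` _ = `]a / k, b / k]%classic); last first.
  by apply/seteqP; split => x /=; rewrite !in_itv/= ltr_pdivrMr// ler_pdivlMr// ![k * _]mulrC.
rewrite !lebesgue_measure_itv /= !lte_fin ltr_pM2r ?invr_gt0//.
case: ifP => // _; rewrite ?mule0// -!EFinD -EFinM; congr (_%:E).
by field; rewrite gt_eqF.
Qed.

End Affine_change.

(* Measurability of a functional on an infinite-dimensional space of coordinates
   is tested along coordinatewise measurable maps, so that no sigma-algebra is
   needed there. *)
Section Iterated.
Context {R : realType} {I : eqType}.
Local Notation mu := (@lebesgue_measure R).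
Implicit Types (F : (I -> R) -> \bar R) (y : I -> R) (s : seq I).

Definition upd y i (t : R) : I -> R := fun j => if j == i then t else y j.

Definition coord_measurable d (T : measurableType d) F :=
  forall phi : T -> I -> R, (forall i, measurable_fun setT (phi ^~ i)) ->
  measurable_fun setT (F \o phi).

Definition mfunctional F := forall d (T : measurableType d), @coord_measurable d T F.

Fixpoint itint s F y : \bar R :=
  if s is i :: s' then \int[mu]_t itint s' F (upd y i t) else F y.

Lemma itint_ge0 s F y : (forall z, 0 <= F z)%E -> (0 <= itint s F y)%E.
Proof.
by move=> F0; elim: s y => //= i s IH y; apply: integral_ge0.
Qed.

Lemma eq_itint s F F' y : F =1 F' -> itint s F y = itint s F' y.
Proof. by move/funext => ->. Qed.

Lemma itint_cat s1 s2 F y : itint (s1 ++ s2) F y = itint s1 (itint s2 F) y.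
Proof. by elim: s1 y => //= i s IH y; apply: eq_integral => t _. Qed.

Lemma measurable_upd d (T : measurableType d) (phi : T -> I -> R) i :
  (forall j, measurable_fun setT (phi ^~ j)) ->
  forall j, measurable_fun setT
    (fun p : T * measurableTypeR R => upd (phi p.1) i p.2 j).
Proof.
move=> mphi j; rewrite /upd; case: eqP => _; first exact: measurable_snd.
by apply: (measurableT_comp (mphi j)); exact: measurable_fst.
Qed.

Lemma itint_measurable s F : (forall z, 0 <= F z)%E ->
  mfunctional F -> mfunctional (itint s F).
Proof.
move=> F0 mF; elim: s => [//|i s IH] d T phi mphi /=.
apply: (@measurable_fun_fubini_tonelli_F _ _ _ _ _ mu
  (fun p => itint s F (upd (phi p.1) i p.2))).
  exact: (IH _ _ (fun p => upd (phi p.1) i p.2) (measurable_upd i mphi)).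
by move=> p; exact: itint_ge0.
Qed.

Lemma updC y i j a b : i != j -> upd (upd y i a) j b = upd (upd y j b) i a.
Proof.
move=> ij; apply/funext => k; rewrite /upd.
by case: (eqVneq k j) => // ->; rewrite eq_sym (negPf ij).
Qed.

Lemma itint_swap i j s F y : i != j -> (forall z, 0 <= F z)%E -> mfunctional F ->
  itint (i :: j :: s) F y = itint (j :: i :: s) F y.
Proof.
move=> ij F0 mF /=.
rewrite (@fubini_tonelli _ _ _ _ _ mu mu
  (fun p => itint s F (upd (upd y i p.1) j p.2))).
- by apply: eq_integral => b _; apply: eq_integral => a _; rewrite /= updC.
- apply: (itint_measurable s F0 mF
    (phi := fun p : measurableTypeR R * measurableTypeR R => upd (upd y i p.1) j p.2)) => k /=.
  apply: (@measurable_upd _ (measurableTypeR R) (fun a => upd y i a)) => k'.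
  by rewrite /upd; case: eqP.
- by move=> p; exact: itint_ge0.
Qed.

Lemma itint_front i s F y : uniq (i :: s) -> (forall z, 0 <= F z)%E ->
  mfunctional F -> itint (rcons s i) F y = itint (i :: s) F y.
Proof.
move=> + F0 mF; elim: s y => [//|j s IH] y /=.
rewrite inE negb_or => /andP[/andP[ij is_]] /andP[_ us].
rewrite -[RHS]/(itint (i :: j :: s) F y) itint_swap//=.
by apply: eq_integral => t _; rewrite IH//= is_.
Qed.

(** The head of [s1] is moved to the front of [s2] by adjacent exchanges, so Tonelli is applied to
    two real variables at a time. *)
Lemma itint_perm s1 s2 F y : uniq s1 -> (forall z, 0 <= F z)%E -> mfunctional F ->
  perm_eq s1 s2 -> itint s1 F y = itint s2 F y.
Proof.
move=> + F0 mF; elim: s1 s2 y => [|i s IH] s2 y.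
  by move=> _; rewrite perm_sym => /perm_nilP ->.
move=> us p.
have is2 : i \in s2 by rewrite -(perm_mem p) mem_head.
case/splitPr: is2 p => p1 p2 p.
have p' : perm_eq s (p1 ++ p2).
  by rewrite -(perm_cons i) (perm_trans p)// perm_catC /= perm_cons perm_catC.
have := us; rewrite (perm_uniq p) => u2.
have u1 : uniq (i :: p1).
  by move: u2; rewrite -cat_rcons cat_uniq rcons_uniq => /andP[].
rewrite -cat_rcons itint_cat.
rewrite itint_front//=; last 2 first.
- by move=> z; exact: itint_ge0.
- exact: itint_measurable.
apply: eq_integral => t _; rewrite -itint_cat; apply: IH => //.
by case/andP: us.
Qed.

End Iterated.

(** Tonelli asks for a sigma-finite structure, while [lebesgue_tuple] is built as a plain measure. A
    proof of sigma-finiteness is turned into such a structure on the same measure. *)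
Lemma sigma_finite_packP d (T : measurableType d) (R : realType)
    (m : {measure set T -> \bar R}) : sigma_finite setT m ->
  exists m' : {sigma_finite_measure set T -> \bar R},
    m' = m :> {measure set T -> \bar R}.
Proof.
case: m => f c h; pose m : {measure set T -> \bar R} := Measure.Pack c.
pose m' : {sigma_finite_measure set T -> \bar R} :=
  HB.pack f (Measure.class m) (@Measure_isSigmaFinite.Build _ _ _ m h).
by exists m'.
Qed.

Section Lebesgue_tuple_iterated.
Context {R : realType} {I : eqType}.
Local Notation mu := (@lebesgue_measure R).

Lemma lebesgue_tuple_sigma_finite n : sigma_finite setT (@lebesgue_tuple R n).
Proof.
pose J (k : nat) : set (measurableTypeR R) := `[- k%:R, k%:R]%classic.
pose B m (k : nat) : set (m.-tuple (measurableTypeR R)) :=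
  \bigcap_(i : 'I_m) ((@tnth m _)^~ i @^-1` J k).
have mB m k : measurable (B m k).
  apply: fin_bigcap_measurable => [|i _]; first exact: finite_finset.
  rewrite -[X in measurable X]setTI.
  by apply: (measurable_tnth (T := measurableTypeR R) i) => //; exact: measurable_itv.
exists (B n) => [|k].
  apply/seteqP; split => // x _.
  exists (Num.truncn (\sum_i `|tnth x i|)).+1 => // i _.
  rewrite /J /= in_itv /= -ler_norml (le_trans _ (ltW (truncnS_gt _)))//.
  by rewrite (bigD1 i)//= lerDl sumr_ge0.
split; first exact: mB.
elim: n => [|n IH]; first by rewrite /= diracE ltry.
rewrite [X in (X < _)%E](_ : _ = (lebesgue_tuple n \x mu)%E (B n k `*` J k)).
  rewrite product_measure1E; [|exact: mB|exact: measurable_itv].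
  apply: lte_mul_pinfty => //; first by rewrite ge0_fin_numE.
  by rewrite [X in (X < _)%E]lebesgue_measure_itv /=; case: ifP; rewrite ?ltry.
rewrite /= /pushforward; congr (product_measure1 _ _ _).
apply/seteqP; split => [[x t] /= h|[x t] [/= hx ht] i _ /=].
  split => [i _|]; last exact: (h ord0 Logic.I).
  by have := h (lift ord0 i) Logic.I; rewrite /= tnthS.
have [->|i0] := eqVneq i ord0; first exact: ht.
have [j ->] : exists j, i = lift ord0 j.
  by case: (unliftP ord0 i) i0 => [j ->|->]; [exists j|rewrite eqxx].
by rewrite tnthS; apply: hx.
Qed.

(** The new head coordinate is the second factor of the product in [tuple_cons_measure], so Tonelli
    makes it the innermost integral: hence [rev s]. The starting point [y] is arbitrary because
    every coordinate that is read gets overwritten. *)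
Lemma integral_lebesgue_tuple n (s : n.-tuple I)
    (F : n.-tuple (measurableTypeR R) -> \bar R) y : uniq s ->
  (forall x, 0 <= F x)%E -> measurable_fun setT F ->
  (\int[lebesgue_tuple n]_x F x =
   itint (rev s) (fun z : I -> R => F (map_tuple z s)) y)%E.
Proof.
elim: n s F y => [|n IH] s F y us F0 mF.
  by rewrite /= integral_dirac// diracT mul1e (tuple0 s)/=; congr F; exact: val_inj.
case/tupleP: s us => c s /= /andP[cs us].
have [m mE] := sigma_finite_packP (lebesgue_tuple_sigma_finite n).
rewrite (integral_pushforwardT _ (@measurable_tuple_cons R n))//=.
rewrite /= -mE (@fubini_tonelli1 _ _ _ _ _ m mu
   (fun p => F (tuple_cons p))); last 2 first.
- exact: measurableT_comp mF (@measurable_tuple_cons R n).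
- by move=> p; exact: F0.
have := IH s (fubini_F mu (fun p => F (tuple_cons p))) y us.
rewrite -mE => ->; last 2 first.
- by move=> x; apply: integral_ge0.
- apply: (@measurable_fun_fubini_tonelli_F _ _ _ _ _ mu
   (fun p => F (tuple_cons p))).
    exact: measurableT_comp mF (@measurable_tuple_cons R n).
  by move=> p; exact: F0.
rewrite rev_cons -cats1 itint_cat; apply: eq_itint => z /=.
apply: eq_integral => t _; congr F; apply: val_inj => /=.
rewrite /upd eqxx; congr (_ :: _); apply/eq_in_map => j js.
by case: eqP => // jc; rewrite -jc js in cs.
Qed.

End Lebesgue_tuple_iterated.

(** * Integration over complex vectors *)

Section Complex_measurable.
Context {R : realType}.
Local Notation C := R[i].
Local Notation mu := (@lebesgue_measure R).

Definition sqmod (z : C) : R := complex.Re z ^+ 2 + complex.Im z ^+ 2.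

Definition cmeasurable d (T : measurableType d) (f : T -> C) :=
  measurable_fun setT (fun t => complex.Re (f t)) /\
  measurable_fun setT (fun t => complex.Im (f t)).

Definition mxmeasurable d (T : measurableType d) m n (A : T -> 'M[C]_(m, n)) :=
  forall i j, cmeasurable (fun t => A t i j).

Section Closure.
Context d (T : measurableType d).
Implicit Types f g : T -> C.

Lemma cmeasurable_cst (z : C) : cmeasurable (fun _ : T => z).
Proof. by split; exact: measurable_cst. Qed.

Lemma cmeasurableD f g : cmeasurable f -> cmeasurable g ->
  cmeasurable (fun t => f t + g t).
Proof.
move=> [f1 f2] [g1 g2]; split.
  rewrite (_ : (fun _ => _) = (fun t => complex.Re (f t) + complex.Re (g t))).
    exact: measurable_funD.
  by apply/funext => t; case: (f t) (g t) => [a b] [a' b'].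
rewrite (_ : (fun _ => _) = (fun t => complex.Im (f t) + complex.Im (g t))).
  exact: measurable_funD.
by apply/funext => t; case: (f t) (g t) => [a b] [a' b'].
Qed.

Lemma cmeasurableN f : cmeasurable f -> cmeasurable (fun t => - f t).
Proof.
move=> [f1 f2]; split.
  rewrite (_ : (fun _ => _) = (fun t => - complex.Re (f t))).
    exact: measurable_funN.
  by apply/funext => t; case: (f t).
rewrite (_ : (fun _ => _) = (fun t => - complex.Im (f t))).
  exact: measurable_funN.
by apply/funext => t; case: (f t).
Qed.

Lemma cmeasurableM f g : cmeasurable f -> cmeasurable g ->
  cmeasurable (fun t => f t * g t).
Proof.
move=> [f1 f2] [g1 g2]; split.
  rewrite (_ : (fun _ => _) = (fun t => complex.Re (f t) * complex.Re (g t)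
     - complex.Im (f t) * complex.Im (g t))).
    by apply: measurable_funB; exact: measurable_funM.
  by apply/funext => t; case: (f t) (g t) => [a b] [a' b'].
rewrite (_ : (fun _ => _) = (fun t => complex.Re (f t) * complex.Im (g t)
   + complex.Im (f t) * complex.Re (g t))).
  by apply: measurable_funD; exact: measurable_funM.
by apply/funext => t; case: (f t) (g t) => [a b] [a' b'].
Qed.

Lemma cmeasurable_conj f : cmeasurable f -> cmeasurable (fun t => Num.conj (f t)).
Proof.
move=> [f1 f2]; split.
  rewrite (_ : (fun _ => _) = (fun t => complex.Re (f t)))//.
  by apply/funext => t; case: (f t).
rewrite (_ : (fun _ => _) = (fun t => - complex.Im (f t))).
  exact: measurable_funN.
by apply/funext => t; case: (f t).
Qed.

Lemma cmeasurable_sum I (r : seq I) (P : pred I) (F : I -> T -> C) :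
  (forall i, cmeasurable (F i)) ->
  cmeasurable (fun t => \sum_(i <- r | P i) F i t).
Proof.
move=> mF; elim: r => [|i r IH].
  under eq_fun do rewrite big_nil; exact: cmeasurable_cst.
under eq_fun do rewrite big_cons; case: (P i) => //.
exact: cmeasurableD.
Qed.

Lemma cmeasurable_prod I (r : seq I) (P : pred I) (F : I -> T -> C) :
  (forall i, cmeasurable (F i)) ->
  cmeasurable (fun t => \prod_(i <- r | P i) F i t).
Proof.
move=> mF; elim: r => [|i r IH].
  under eq_fun do rewrite big_nil; exact: cmeasurable_cst.
under eq_fun do rewrite big_cons; case: (P i) => //.
exact: cmeasurableM.
Qed.

Lemma measurable_sqmod f : cmeasurable f -> measurable_fun setT (fun t => sqmod (f t)).
Proof.
by move=> [f1 f2]; apply: measurable_funD; exact: measurable_funX.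
Qed.

Lemma mxmeasurable_mul m n p (A : T -> 'M[C]_(m, n)) (B : T -> 'M[C]_(n, p)) :
  mxmeasurable A -> mxmeasurable B -> mxmeasurable (fun t => A t *m B t).
Proof.
move=> mA mB i j; under eq_fun do rewrite mxE.
by apply: cmeasurable_sum => k; exact: cmeasurableM.
Qed.

Lemma mxmeasurable_cst m n (A : 'M[C]_(m, n)) : mxmeasurable (fun _ : T => A).
Proof. by move=> i j; exact: cmeasurable_cst. Qed.

Lemma mxmeasurableD m n (A B : T -> 'M[C]_(m, n)) :
  mxmeasurable A -> mxmeasurable B -> mxmeasurable (fun t => A t + B t).
Proof.
by move=> mA mB i j; under eq_fun do rewrite mxE; exact: cmeasurableD.
Qed.

Lemma mxmeasurableN m n (A : T -> 'M[C]_(m, n)) :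
  mxmeasurable A -> mxmeasurable (fun t => - A t).
Proof.
by move=> mA i j; under eq_fun do rewrite mxE; exact: cmeasurableN.
Qed.

Lemma mxmeasurableZ m n (f : T -> C) (A : T -> 'M[C]_(m, n)) :
  cmeasurable f -> mxmeasurable A -> mxmeasurable (fun t => f t *: A t).
Proof.
by move=> mf mA i j; under eq_fun do rewrite mxE; exact: cmeasurableM.
Qed.

Lemma mxmeasurable_adj m n (A : T -> 'M[C]_(m, n)) :
  mxmeasurable A -> mxmeasurable (fun t => (A t) ^t*).
Proof.
by move=> mA i j; under eq_fun do rewrite !mxE; exact: cmeasurable_conj.
Qed.

Lemma mxmeasurable_scalar n (f : T -> C) :
  cmeasurable f -> mxmeasurable (fun t => (f t)%:M : 'M[C]_n).
Proof.
move=> mf i j; under eq_fun do rewrite mxE.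
by case: eqP => // _; exact: cmeasurable_cst.
Qed.

Lemma mxmeasurable_col m1 m2 n (A : T -> 'M[C]_(m1, n)) (B : T -> 'M[C]_(m2, n)) :
  mxmeasurable A -> mxmeasurable B -> mxmeasurable (fun t => col_mx (A t) (B t)).
Proof.
by move=> mA mB i j; under eq_fun do rewrite mxE; case: splitP.
Qed.

Lemma mxmeasurable_cons n (f : T -> C) (v : T -> 'cV[C]_n) :
  cmeasurable f -> mxmeasurable v ->
  mxmeasurable (fun t => col_mx (f t)%:M (v t) : 'cV[C]_n.+1).
Proof.
move=> mf mv; apply: (@mxmeasurable_col 1 n 1) => //.
exact: mxmeasurable_scalar.
Qed.

Lemma cmeasurable_comp d' (T' : measurableType d') (g : T' -> T) f :
  cmeasurable f -> measurable_fun setT g -> cmeasurable (fun t => f (g t)).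
Proof.
by case=> f1 f2 mg; split; [exact: measurableT_comp f1 mg|exact: measurableT_comp f2 mg].
Qed.

Lemma cmeasurable_det n (A : T -> 'M[C]_n) :
  mxmeasurable A -> cmeasurable (fun t => \det (A t)).
Proof.
move=> mA; apply: cmeasurable_sum => s; apply: cmeasurableM.
  exact: cmeasurable_cst.
exact: cmeasurable_prod.
Qed.

End Closure.

(** As for [mfunctional], measurability is tested along coordinatewise measurable maps, so that
    complex numbers and vectors carry no sigma-algebra. The variant [pfunctional] adds a parameter,
    for joint measurability. *)
Definition cfunctional (G : C -> \bar R) :=
  forall d (T : measurableType d) (f : T -> C), cmeasurable f ->
  measurable_fun setT (fun t => G (f t)).

Definition vfunctional n (F : 'cV[C]_n -> \bar R) :=
  forall d (T : measurableType d) (v : T -> 'cV[C]_n), mxmeasurable v ->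
  measurable_fun setT (fun t => F (v t)).

Definition pfunctional d0 (T0 : measurableType d0) n
    (F : T0 -> 'cV[C]_n -> \bar R) :=
  forall d (T : measurableType d) (p : T -> T0) (v : T -> 'cV[C]_n),
  measurable_fun setT p -> mxmeasurable v ->
  measurable_fun setT (fun t => F (p t) (v t)).

Definition cint (G : C -> \bar R) : \bar R :=
  (\int[mu]_a \int[mu]_b G (a +i* b))%E.

Lemma cint_ge0 G : (forall z, 0 <= G z)%E -> (0 <= cint G)%E.
Proof.
by move=> G0; apply: integral_ge0 => a _; apply: integral_ge0.
Qed.

Lemma eq_cint G G' : G =1 G' -> cint G = cint G'.
Proof. by move/funext => ->. Qed.

Lemma cmeasurable_pair :
  cmeasurable (fun p : measurableTypeR R * measurableTypeR R => p.1 +i* p.2).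
Proof. by split => /=; [exact: measurable_fst|exact: measurable_snd]. Qed.

Lemma cmeasurable_re (a : R) :
  cmeasurable (fun b : measurableTypeR R => a +i* b).
Proof. by split => /=; [exact: measurable_cst|exact: measurable_id]. Qed.

Lemma cfunctional_inner G : (forall z, 0 <= G z)%E -> cfunctional G ->
  measurable_fun [set: measurableTypeR R] (fun a => \int[mu]_b G (a +i* b))%E.
Proof.
move=> G0 mG.
apply: (@measurable_fun_fubini_tonelli_F _ _ _ _ _ mu
  (fun p => G (p.1 +i* p.2))) => //.
exact: (mG _ _ _ cmeasurable_pair).
Qed.

Lemma cint_measurable d (T : measurableType d) (G : T -> C -> \bar R) :
  (forall t z, 0 <= G t z)%E ->
  (forall d' (T' : measurableType d') (p : T' -> T) (f : T' -> C),
     measurable_fun setT p -> cmeasurable f ->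
     measurable_fun setT (fun t => G (p t) (f t))) ->
  measurable_fun setT (fun t => cint (G t)).
Proof.
move=> G0 mG; apply: (@measurable_fun_fubini_tonelli_F _ _ _ _ _ mu
  (fun p : T * measurableTypeR R => \int[mu]_b G p.1 (p.2 +i* b))%E); last first.
  by move=> p; exact: integral_ge0.
apply: (@measurable_fun_fubini_tonelli_F _ _ _ _ _ mu
  (fun p : T * measurableTypeR R * measurableTypeR R =>
     G p.1.1 (p.1.2 +i* p.2))%E) => //.
apply: mG; first by apply: measurableT_comp; exact: measurable_fst.
split => /=; last exact: measurable_snd.
by apply: (measurableT_comp measurable_snd); exact: measurable_fst.
Qed.

Lemma cint_translate (h : C) G : (forall z, 0 <= G z)%E -> cfunctional G ->
  cint (fun z => G (z + h)) = cint G.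
Proof.
case: h => h k G0 mG; rewrite /cint.
rewrite -(@integral_translate _ h (fun a => \int[mu]_b G (a +i* b))%E); last 2 first.
- exact: cfunctional_inner.
- by move=> a; apply: integral_ge0.
apply: eq_integral => a _.
rewrite -(@integral_translate _ k (fun b => G ((a + h)%R +i* b)))//.
exact: (mG _ _ _ (cmeasurable_re (a + h))).
Qed.

Lemma cint_scale (k : R) G : 0 < k -> (forall z, 0 <= G z)%E -> cfunctional G ->
  cint G = ((k ^+ 2)%:E * cint (fun z => G (k%:C * z)%R))%E.
Proof.
move=> k0 G0 mG; rewrite /cint.
rewrite (integral_scale k0); last 2 first.
- exact: cfunctional_inner.
- by move=> a; apply: integral_ge0.
rewrite expr2 EFinM -muleA; congr (_ * _)%E.
rewrite -ge0_integralZl//; last 3 first.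
- apply: (@cfunctional_inner (fun z => G (k%:C * z))) => // d T f mf; apply: mG.
  by apply: cmeasurableM => //; exact: cmeasurable_cst.
- by move=> a _; apply: integral_ge0.
- by rewrite lee_fin ltW.
apply: eq_integral => a _.
rewrite (integral_scale k0)//; last exact: (mG _ _ _ (cmeasurable_re (k * a))).
congr (_ * _)%E; apply: eq_integral => b _; congr G.
by rewrite /GRing.mul /=; congr (_ +i* _); rewrite ?mul0r ?subr0 ?addr0.
Qed.

Lemma cintZl (k : \bar R) G : (0 <= k)%E -> (forall z, 0 <= G z)%E ->
  cfunctional G -> cint (fun z => k * G z)%E = (k * cint G)%E.
Proof.
move=> k0 G0 mG; rewrite /cint -ge0_integralZl//; last 2 first.
- exact: cfunctional_inner.
- by move=> a _; apply: integral_ge0.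
apply: eq_integral => a _; rewrite ge0_integralZl//.
exact: (mG _ _ _ (cmeasurable_re a)).
Qed.

(* Coordinates are integrated one after the other, so that Tonelli is only
   needed for pairs of one-dimensional integrals. *)
Fixpoint vint n : ('cV[C]_n -> \bar R) -> \bar R :=
  match n return ('cV[C]_n -> \bar R) -> \bar R with
  | 0 => fun F => F 0
  | n'.+1 => fun F => cint (fun z => vint (fun v : 'cV_n' => F (col_mx z%:M v)))
  end.

Lemma vint_ge0 n (F : 'cV[C]_n -> \bar R) : (forall v, 0 <= F v)%E -> (0 <= vint F)%E.
Proof.
by elim: n F => //= n IH F F0; apply: cint_ge0 => z; exact: IH.
Qed.

Lemma eq_vint n (F F' : 'cV[C]_n -> \bar R) : F =1 F' -> vint F = vint F'.
Proof. by move/funext => ->. Qed.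

(** The parameter space has to vary in the induction: once the first coordinate is fixed, it becomes
    part of the parameter. *)
Lemma vint_measurable d (T : measurableType d) n (F : T -> 'cV[C]_n -> \bar R) :
  (forall t v, 0 <= F t v)%E -> pfunctional F ->
  measurable_fun setT (fun t => vint (F t)).
Proof.
elim: n d T F => [|n IH] d T F F0 mF /=.
  by apply: mF => //; exact: mxmeasurable_cst.
apply: cint_measurable => [t z|d' T' p f mp mf]; first exact: vint_ge0.
apply: IH => // d2 T2 q v mq mv; apply: mF; first exact: measurableT_comp.
apply: mxmeasurable_cons => //; exact: cmeasurable_comp.
Qed.

Lemma cfunctional_vint n (F : 'cV[C]_n.+1 -> \bar R) :
  (forall v, 0 <= F v)%E -> vfunctional F ->
  cfunctional (fun z => vint (fun v : 'cV_n => F (col_mx z%:M v))).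
Proof.
move=> F0 mF d T f mf; apply: vint_measurable => // d2 T2 q v mq mv; apply: mF.
apply: mxmeasurable_cons => //; exact: cmeasurable_comp.
Qed.

Lemma vfunctional_col n (F : 'cV[C]_n.+1 -> \bar R) z :
  vfunctional F -> vfunctional (fun v : 'cV_n => F (col_mx z%:M v)).
Proof.
move=> mF d T v mv; apply: mF; apply: mxmeasurable_cons => //.
Qed.

Lemma vintZl n (k : \bar R) (F : 'cV[C]_n -> \bar R) :
  (0 <= k)%E -> (forall v, 0 <= F v)%E -> vfunctional F ->
  vint (fun v => k * F v)%E = (k * vint F)%E.
Proof.
elim: n F => //= n IH F k0 F0 mF.
rewrite -cintZl; last 3 first.
- exact: k0.
- by move=> z; exact: vint_ge0.
- exact: cfunctional_vint.
by apply: eq_cint => z; rewrite IH//; exact: vfunctional_col.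
Qed.

Lemma vint_tonelli n (F : measurableTypeR R -> 'cV[C]_n -> \bar R) :
  (forall t v, 0 <= F t v)%E -> pfunctional F ->
  (\int[mu]_t vint (F t) = vint (fun v => \int[mu]_t F t v))%E.
Proof.
elim: n F => [|n IH] F F0 mF; first by [].
rewrite /= /cint.
have mF2 : measurable_fun setT (fun p : measurableTypeR R * measurableTypeR R * measurableTypeR R =>
    vint (fun v : 'cV_n => F p.1.1 (col_mx (p.1.2 +i* p.2)%:M v))).
  apply: vint_measurable => // d T p v mp mv; apply: mF.
    by do 2 apply: (measurableT_comp measurable_fst).
  apply: mxmeasurable_cons => //; split => /=.
    by apply: (measurableT_comp measurable_snd); exact: measurableT_comp measurable_fst mp.
  exact: (measurableT_comp measurable_snd).
have J0 t z : (0 <= vint (fun v : 'cV_n => F t (col_mx z%:M v)))%E by exact: vint_ge0.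
rewrite (@fubini_tonelli _ _ _ _ _ mu mu (fun p =>
  \int[mu]_b vint (fun v : 'cV_n => F p.1 (col_mx (p.2 +i* b)%:M v)))%E); last 2 first.
- by apply: (@measurable_fun_fubini_tonelli_F _ _ _ _ _ mu _ mF2) => p; exact: J0.
- by move=> p; exact: integral_ge0.
apply: eq_integral => a _; rewrite /fubini_G /=.
rewrite (@fubini_tonelli _ _ _ _ _ mu mu (fun p =>
  vint (fun v : 'cV_n => F p.1 (col_mx (a +i* p.2)%:M v)))%E)//; last first.
  pose g (p : measurableTypeR R * measurableTypeR R) := ((p.1, a), p.2).
  apply: (measurableT_comp mF2 (_ : measurable_fun [set: measurableTypeR R * measurableTypeR R] g)).
  apply: measurable_fun_pair; last exact: measurable_snd.
  by apply: measurable_fun_pair; [exact: measurable_fst|exact: measurable_cst].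
apply: eq_integral => b _; rewrite /fubini_G /= IH// => d T p v mp mv; apply: mF => //.
by apply: mxmeasurable_cons => //; exact: cmeasurable_cst.
Qed.

(** Two exchanges with a real variable. In [adapted_factor] this makes the first coordinate the
    innermost one, where it can be translated by a function of the others. *)
Lemma vint_cint n (F : C -> 'cV[C]_n -> \bar R) : (forall z v, 0 <= F z v)%E ->
  (forall d (T : measurableType d) (f : T -> C) (v : T -> 'cV[C]_n),
    cmeasurable f -> mxmeasurable v -> measurable_fun setT (fun t => F (f t) (v t))) ->
  cint (fun z => vint (F z)) = vint (fun v => cint (fun z => F z v)).
Proof.
move=> F0 mF; rewrite /cint.
under eq_integral => a _.
  rewrite vint_tonelli//; last first.
    by move=> d T p v mp mv; apply: mF => //; split.
  over.
rewrite vint_tonelli// => [t v|]; first exact: integral_ge0.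
move=> d T p v mp mv.
apply: (@measurable_fun_fubini_tonelli_F _ _ _ _ _ mu
  (fun q => F (p q.1 +i* q.2) (v q.1))) => //.
apply: mF => [|i j].
  by split => /=; [exact: measurableT_comp measurable_fst|exact: measurable_snd].
have [v1 v2] := mv i j.
by split; [exact: (measurableT_comp v1 measurable_fst)|exact: (measurableT_comp v2 measurable_fst)].
Qed.

Lemma vint_translate n (h : 'cV[C]_n) F : (forall v, 0 <= F v)%E -> vfunctional F ->
  vint (fun v => F (v + h)) = vint F.
Proof.
elim: n h F => [|n IH] h F F0 mF /=; first by rewrite [h]flatmx0 addr0.
rewrite -(@cint_translate (h 0 0) (fun z => vint (fun v : 'cV_n => F (col_mx z%:M v)))); last 2 first.
- by move=> z; exact: vint_ge0.
- exact: cfunctional_vint.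
apply: eq_cint => z; rewrite -(IH (dsubmx (h : 'cV_(1 + n))) (fun v => F (col_mx (z + h 0 0)%:M v)))//; last first.
  exact: vfunctional_col.
apply: eq_vint => v; congr F.
rewrite -[X in _ + X](@vsubmxK _ 1 n 1 h) [LHS](@add_col_mx _ 1 n 1); congr (@col_mx _ 1 n 1 _ _).
apply/matrixP => i j; rewrite !ord1 !mxE eqxx !mulr1n; congr (_ + h _ _).
exact: val_inj.
Qed.

Lemma vint_scale n (k : R) F : 0 < k -> (forall v, 0 <= F v)%E -> vfunctional F ->
  vint F = ((k ^+ n.*2)%:E * vint (fun v : 'cV[C]_n => F (k%:C *: v)%R))%E.
Proof.
move=> k0; elim: n F => [|n IH] F F0 mF /=; first by rewrite scaler0 mul1e.
have k0' : (0 <= (k ^+ n.*2)%:E)%E by rewrite lee_fin exprn_ge0// ltW.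
have mFk : vfunctional (fun v => F (k%:C *: v)).
  move=> d T v mv; apply: mF; apply: mxmeasurableZ => //; exact: cmeasurable_cst.
rewrite (cint_scale k0); last 2 first.
- by move=> z; exact: vint_ge0.
- exact: cfunctional_vint.
rewrite doubleS -[n.*2.+2]add2n (exprD k 2) (EFinM (k ^+ 2) (k ^+ n.*2)) -[RHS]muleA; congr (_ * _)%E.
rewrite -[X in (_ * X)%E]/(cint (fun z => vint (fun v : 'cV_n =>
  F (k%:C *: (col_mx z%:M v : 'cV_n.+1))%R))) -cintZl; last 3 first.
- exact: k0'.
- by move=> z; exact: vint_ge0.
- exact: (@cfunctional_vint n (fun v => F (k%:C *: v))).
apply: eq_cint => z; rewrite IH//; last exact: vfunctional_col.
congr (_ * _)%E; apply: eq_vint => v; congr F.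
by rewrite [RHS](@scale_col_mx _ 1 n 1) scale_scalar_mx.
Qed.

End Complex_measurable.

(** * Polar coordinates in the complex plane, in terms of the squared modulus *)

Section Radial.
Context {R : realType}.
Local Notation C := R[i].
Local Notation mu := (@lebesgue_measure R).

Let rad (p : measurableTypeR R * measurableTypeR R) : measurableTypeR R :=
  sqmod (p.1 +i* p.2).

Let mrad : measurable_fun setT rad.
Proof. exact: measurable_sqmod (@cmeasurable_pair R). Qed.

(** Its value is pi, but it only enters as a finite nonnegative constant. *)
Definition disc_area : R := fine (cint (fun z : C => (\1_[set w | sqmod w < 1] z)%:E)).

Let push : {measure set (measurableTypeR R) -> \bar R} :=
  measure_function_pushforward__canonical__measure_function_Measure (mu \x mu)%E mrad.

Lemma sqmod_ge0 (z : C) : 0 <= sqmod z.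
Proof. by rewrite addr_ge0 ?sqr_ge0. Qed.

Lemma sqmodM (z w : C) : sqmod (z * w) = sqmod z * sqmod w.
Proof. by case: z w => [a b] [c d]; rewrite /sqmod /=; ring. Qed.

Lemma sqmod_real (k : R) : sqmod k%:C = k ^+ 2.
Proof. by rewrite /sqmod /= expr0n addr0. Qed.

Lemma cfunctional_sqmod (g : R -> \bar R) : measurable_fun setT g ->
  cfunctional (fun z : C => g (sqmod z)).
Proof.
by move=> mg d T f mf; apply: measurableT_comp mg (measurable_sqmod mf).
Qed.

Lemma measurable_indic_EFin d (T : measurableType d) (A : set T) :
  measurable A -> measurable_fun setT (fun x => (\1_A x : R)%:E).
Proof. by move=> mA; apply/measurable_EFinP; exact: measurable_indic. Qed.

Let cint_sqmodE (g : R -> \bar R) : measurable_fun setT g ->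
  (forall x, 0 <= g x)%E ->
  cint (fun z => g (sqmod z)) = (\int[push]_(y in `[0%R, +oo[) g y)%E.
Proof.
move=> mg g0.
rewrite (ge0_integral_pushforward mrad (mu \x mu)%E (measurable_itv _) (measurable_funTS mg))//.
rewrite (_ : _ @^-1` _ = setT); last first.
  by apply/seteqP; split => // p _; rewrite /= in_itv/= andbT sqmod_ge0.
rewrite (@fubini_tonelli1 _ _ _ _ _ mu mu (fun p => g (rad p)))//.
exact: (measurableT_comp (mg : measurable_fun [set: measurableTypeR R] g) mrad).
Qed.

Let discE r : push `]-oo, r[%classic =
  cint (fun z : C => (\1_[set w | sqmod w < r] z)%:E).
Proof.
have mB : measurable (rad @^-1` `]-oo, r[%classic).
  by rewrite -[X in measurable X]setTI; apply: mrad => //; exact: measurable_itv.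
transitivity (\int[mu \x mu]_p (\1_(rad @^-1` `]-oo, r[%classic) p)%:E)%E.
  by rewrite integral_indic ?setIT.
rewrite (@fubini_tonelli1 _ _ _ _ _ mu mu
  (fun p => (\1_(rad @^-1` `]-oo, r[%classic) p)%:E)); last 2 first.
- exact: measurable_indic_EFin.
- by move=> p; rewrite lee_fin.
by apply: eq_integral => a _; apply: eq_integral.
Qed.

Let mdisc r : cfunctional (fun z : C => (\1_[set w | sqmod w < r] z)%:E).
Proof.
move=> d T f mf.
rewrite (_ : (fun _ => _) = (fun t => (\1_`]-oo, r[%classic (sqmod (f t)))%:E)).
  apply: (measurableT_comp (f := fun y : R => (\1_`]-oo, r[%classic y)%:E)); last exact: measurable_sqmod.
  by apply: measurable_indic_EFin; exact: measurable_itv.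
apply/funext => t; congr (_%:E).
Qed.

Let indic_ge0 r (z : C) : (0 <= (\1_[set w | sqmod w < r] z : R)%:E)%E.
Proof. by rewrite lee_fin. Qed.

Lemma disc_area_ge0 : 0 <= disc_area.
Proof. by rewrite fine_ge0// cint_ge0. Qed.

Let disc1 : cint (fun z : C => (\1_[set w | sqmod w < 1] z)%:E) = disc_area%:E.
Proof.
rewrite fineK// ge0_fin_numE; last by rewrite cint_ge0.
rewrite -discE /= /pushforward.
have KP (x y : R) : x ^+ 2 + y ^+ 2 < 1 -> -1 <= x <= 1.
  by move=> h; apply/andP; split; nra.
pose K : set (measurableTypeR R) := `[-1, 1]%classic.
apply: (@le_lt_trans _ _ ((mu \x mu)%E (K `*` K))).
  apply: (le_measure (mu \x mu)%E); rewrite ?inE.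
  - by rewrite -[X in measurable X]setTI; apply: mrad => //; exact: measurable_itv.
  - by apply: measurableX; exact: measurable_itv.
  - move=> [a b]; rewrite /= !in_itv/= /rad /sqmod /= => h.
    by split; [exact: KP h|apply: (KP _ a); rewrite addrC].
rewrite product_measure1E; [|exact: measurable_itv|exact: measurable_itv].
rewrite /K [X in (X * _)%E]lebesgue_measure_itv [X in (_ * X)%E]lebesgue_measure_itv /=.
by case: ifP => _; rewrite -?EFinD -?EFinM ?mul0e ltry.
Qed.

Let push_disc r : 0 < r -> push `]-oo, r[%classic = (disc_area * r)%:E.
Proof.
move=> r0; rewrite discE (@cint_scale _ (Num.sqrt r))//; last by rewrite sqrtr_gt0.
rewrite (sqr_sqrtr (ltW r0)) mulrC EFinM -disc1; congr (_ * _)%E.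
apply: eq_cint => z; congr (_%:E); rewrite ?indicE; congr ((_ : bool)%:R).
apply/idP/idP; rewrite !inE/= sqmodM sqmod_real sqr_sqrtr ?ltW//.
  by rewrite -ltr_pdivlMl// mulVf// gt_eqF.
by rewrite -ltr_pdivlMl// mulVf// gt_eqF.
Qed.

Let push_disc0 r : r <= 0 -> push `]-oo, r[%classic = 0%E.
Proof.
move=> r0; rewrite /= /pushforward (_ : _ @^-1` _ = set0) ?measure0//.
apply/seteqP; split => // p; rewrite /= in_itv/= => h.
by have := le_lt_trans (sqmod_ge0 _) (lt_le_trans h r0); rewrite ltxx.
Qed.

(** The rays []-oo, r[] generate the Borel sets and are stable under intersection, and by scaling
    the disc of squared radius [r] has area [disc_area * r]. Hence the squared modulus, unlike the
    modulus, carries planar measure to a constant multiple of Lebesgue measure on the half-line. *)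
Let pushE (A : set (measurableTypeR R)) : measurable A -> A `<=` `[0, +oo[%classic ->
  push A = (disc_area%:E * mu A)%E.
Proof.
move=> mA AD.
have mD : measurable (`[0, +oo[%classic : set (measurableTypeR R)) by exact: measurable_itv.
have -> : (disc_area%:E * mu A)%E = mscale (NngNum disc_area_ge0) (mrestr mu mD) A.
  by rewrite /mscale /= /mrestr setIidl.
apply: (@measure_unique _ R (measurableTypeR R) (@RGenInftyO.G R)
  (fun n => `]-oo, n%:R[%classic) _ _ _ _ push
  (mscale (NngNum disc_area_ge0) (mrestr mu mD))) => //.
- exact: RGenInftyO.measurableE.
- move=> _ _ [x ->] [y ->]; exists (Num.min x y).
  by apply/seteqP; split => z /=; rewrite !in_itv/= lt_min; [move=> [-> ->]|move=> /andP[-> ->]].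
- by move=> i; exists i%:R.
- apply/seteqP; split => // x _; exists (Num.truncn `|x|).+1 => //=.
  by rewrite in_itv/= (le_lt_trans (ler_norm x))// truncnS_gt.
- move=> _ [x ->].
  rewrite -[RHS]/(disc_area%:E * mu (`]-oo, x[%classic `&` `[0%R, +oo[%classic))%E.
  have [x0|x0] := leP x 0.
    rewrite push_disc0// (_ : _ `&` _ = set0) ?measure0 ?mule0//.
    apply/seteqP; split => // y /=; rewrite !in_itv/= andbT => -[yx y0].
    by have := le_lt_trans y0 (lt_le_trans yx x0); rewrite ltxx.
  rewrite push_disc// (_ : _ `&` _ = `[0, x[%classic); last first.
    by apply/seteqP; split => y /=; rewrite !in_itv/= andbT; [move=> [-> ->]|move=> /andP[-> ->]].
  by rewrite lebesgue_measure_itv /= lte_fin x0 oppr0 adde0 EFinM.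
- move=> k; have [->|k0] := eqVneq k 0%N; first by rewrite push_disc0.
  by rewrite push_disc ?ltry// ltr0n lt0n.
Qed.

Lemma cint_radial (g : R -> \bar R) : measurable_fun setT g ->
  (forall x, 0 <= g x)%E ->
  cint (fun z => g (sqmod z)) = (disc_area%:E * \int[mu]_(y in `[0%R, +oo[) g y)%E.
Proof.
move=> mg g0; rewrite cint_sqmodE//.
have mD : measurable (`[0, +oo[%classic : set (measurableTypeR R)) by exact: measurable_itv.
rewrite -[disc_area]/((NngNum disc_area_ge0)%:num) -ge0_integral_mscale//; last exact: measurable_funTS.
by apply: eq_measure_integral => A mA AD; rewrite pushE.
Qed.

End Radial.

Section Ball.
Context {R : realType}.
Local Notation C := R[i].

(** The cut-off at [0 < r] also acts for [m = 0], the exponent met when [M = N]: the weight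
    [pospow m (1 - sqnorm v)] lives on the open unit ball for every [m]. *)
Definition pospow (m : nat) (r : R) : R := if 0 < r then r ^+ m else 0.

Definition sqnorm n (v : 'cV[C]_n) : R := \sum_i sqmod (v i 0).

Lemma pospow_ge0 m r : 0 <= pospow m r.
Proof. by rewrite /pospow; case: ifP => // r0; rewrite exprn_ge0// ltW. Qed.

Lemma measurable_pospow m : measurable_fun setT (pospow m).
Proof.
apply: measurable_fun_ifT.
- by apply: measurable_fun_ltr => //; exact: measurable_cst.
- exact: exprn_measurable.
- exact: measurable_cst.
Qed.

Lemma pospowM m r s : 0 < r -> pospow m (r * s) = r ^+ m * pospow m s.
Proof.
by move=> r0; rewrite /pospow pmulr_rgt0//; case: ifP; rewrite ?mulr0 ?exprMn.
Qed.

Definition ball_volume n m : \bar R := vint (fun v : 'cV[C]_n => (pospow m (1 - sqnorm v))%:E).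

Lemma sqnorm_cons n (z : C) (v : 'cV[C]_n) :
  sqnorm (col_mx z%:M v : 'cV_n.+1) = sqmod z + sqnorm v.
Proof.
rewrite /sqnorm big_ord_recl; congr (sqmod _ + _).
  by rewrite mxE; case: splitP => // j _; rewrite !ord1 mxE eqxx.
apply: eq_bigr => i _; rewrite mxE; case: splitP => [j|k] /=.
  by rewrite ord1.
by rewrite /bump /= => -[ik]; congr (sqmod (v _ _)); exact: val_inj.
Qed.

Lemma sqnormZ n (k : C) (v : 'cV[C]_n) : sqnorm (k *: v) = sqmod k * sqnorm v.
Proof.
by rewrite /sqnorm mulr_sumr; apply: eq_bigr => i _; rewrite mxE sqmodM.
Qed.

Lemma sqnorm_ge0 n (v : 'cV[C]_n) : 0 <= sqnorm v.
Proof. by apply: sumr_ge0 => i _; exact: sqmod_ge0. Qed.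

Lemma measurable_sqnorm d (T : measurableType d) n (v : T -> 'cV[C]_n) :
  mxmeasurable v -> measurable_fun setT (fun t => sqnorm (v t)).
Proof.
by move=> mv; apply: measurable_sum => i; exact: measurable_sqmod.
Qed.

Lemma vfunctional_sqnorm n (g : R -> R) : measurable_fun setT g ->
  vfunctional (fun v : 'cV[C]_n => (g (sqnorm v))%:E).
Proof.
move=> mg d T v mv; apply/measurable_EFinP.
exact: measurableT_comp mg (measurable_sqnorm mv).
Qed.

(** Scaling [v] by [sqrt r] contributes [r ^ n] from the volume of [n] complex coordinates and
    [r ^ m] from the weight. This is the marginalization that turns exponent [m] on the ball into
    [m + n] for a single coordinate. For [r <= 0] both sides vanish. *)
Lemma vint_ball n m (r : R) :
  vint (fun v : 'cV[C]_n => (pospow m (r - sqnorm v))%:E) =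
  ((pospow (m + n) r)%:E * ball_volume n m)%E.
Proof.
have mF s : vfunctional (fun v : 'cV[C]_n => (pospow m (s - sqnorm v))%:E).
  apply: (@vfunctional_sqnorm _ (fun x => pospow m (s - x))).
  by apply: measurableT_comp (measurable_pospow m) _; exact: measurable_funB.
have F0 s (v : 'cV[C]_n) : (0 <= (pospow m (s - sqnorm v))%:E)%E.
  by rewrite lee_fin pospow_ge0.
rewrite [pospow (m + n) r]/pospow; case: ifP => r0; last first.
  rewrite mul0e -(mul0e (ball_volume n m)) -vintZl//; apply: eq_vint => v.
  rewrite mul0e /pospow; case: ifP => // h.
  by move: r0; rewrite (lt_le_trans h)// gerBl sqnorm_ge0.
rewrite (@vint_scale _ _ (Num.sqrt r)) ?sqrtr_gt0//.
rewrite -muln2 mulnC exprM sqr_sqrtr ?ltW// exprD mulrC EFinM -muleA; congr (_ * _)%E.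
rewrite -vintZl//; last by rewrite lee_fin exprn_ge0// ltW.
apply: eq_vint => v; rewrite -EFinM -pospowM//; congr (pospow _ _)%:E.
by rewrite sqnormZ sqmod_real sqr_sqrtr ?ltW//; ring.
Qed.

End Ball.

(** * Positive definite matrices *)

Section Adjoint.
Context {C : numClosedFieldType}.

Lemma adjmxM m n p (A : 'M[C]_(m, n)) (B : 'M[C]_(n, p)) :
  (A *m B) ^t* = B ^t* *m A ^t*.
Proof. by rewrite trmx_mul map_mxM. Qed.

Lemma adjmxD m n (A B : 'M[C]_(m, n)) : (A + B) ^t* = A ^t* + B ^t*.
Proof. by apply/matrixP => i j; rewrite !mxE rmorphD. Qed.

Lemma adjmxN m n (A : 'M[C]_(m, n)) : (- A) ^t* = - A ^t*.
Proof. by apply/matrixP => i j; rewrite !mxE rmorphN. Qed.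

Lemma adjmxZ m n (k : C) (A : 'M[C]_(m, n)) : (k *: A) ^t* = Num.conj k *: A ^t*.
Proof. by apply/matrixP => i j; rewrite !mxE rmorphM. Qed.

Lemma adjmx0 m n : (0 : 'M[C]_(m, n)) ^t* = 0.
Proof. by apply/matrixP => i j; rewrite !mxE rmorph0. Qed.

Lemma adjmx_scalar n (k : C) : (k%:M : 'M[C]_n) ^t* = (Num.conj k)%:M.
Proof. by apply/matrixP => i j; rewrite !mxE eq_sym rmorphMn. Qed.

Lemma adjmx1 n : (1%:M : 'M[C]_n) ^t* = 1%:M.
Proof. by rewrite adjmx_scalar rmorph1. Qed.

Lemma adjmx_block m1 m2 n1 n2 (A : 'M[C]_(m1, n1)) (B : 'M[C]_(m1, n2))
    (D : 'M[C]_(m2, n1)) (E : 'M[C]_(m2, n2)) :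
  (block_mx A B D E) ^t* = block_mx (A ^t*) (D ^t*) (B ^t*) (E ^t*).
Proof. by rewrite tr_block_mx map_block_mx. Qed.

Lemma adjmx_col m1 m2 n (A : 'M[C]_(m1, n)) (B : 'M[C]_(m2, n)) :
  (col_mx A B) ^t* = row_mx (A ^t*) (B ^t*).
Proof. by rewrite tr_col_mx map_row_mx. Qed.

Lemma adjmx_row m n1 n2 (A : 'M[C]_(m, n1)) (B : 'M[C]_(m, n2)) :
  (row_mx A B) ^t* = col_mx (A ^t*) (B ^t*).
Proof. by rewrite tr_row_mx map_col_mx. Qed.

Lemma det_adjmx n (A : 'M[C]_n) : \det (A ^t*) = Num.conj (\det A).
Proof. by rewrite det_map_mx det_tr. Qed.

Lemma adjmx_unit n (A : 'M[C]_n) : (A ^t* \in unitmx) = (A \in unitmx).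
Proof. by rewrite !unitmxE det_adjmx !unitfE conjC_eq0. Qed.

End Adjoint.

Section PositiveDefinite.
Context {R : realType}.
Local Notation C := R[i].

Lemma sqmodE (z : C) : (sqmod z)%:C = z * Num.conj z.
Proof.
by case: z => a b; apply/eqP; rewrite eq_complex /sqmod /=; apply/andP; split; apply/eqP; ring.
Qed.

Lemma conj_invr (c : C) : 0 < c -> Num.conj c^-1 = c^-1.
Proof. by move=> c0; apply/CrealP; rewrite realV gtr0_real. Qed.

Lemma posdef_congr n (A W : 'M[C]_n) : W \in unitmx ->
  posdefmx A -> posdefmx (W *m A *m W ^t*).
Proof.
move=> uW [hA pA]; split; first by rewrite !adjmxM trmxCK hA mulmxA.
move=> v v0; have := pA (W ^t* *m v).
rewrite adjmxM trmxCK !mulmxA; apply; apply: contraNneq v0 => h.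
by rewrite -[v]mul1mx -(@mulVmx _ _ (W ^t*)) ?adjmx_unit// -mulmxA h mulmx0.
Qed.

Lemma posdef_congrE n (A W : 'M[C]_n) : W \in unitmx ->
  posdefmx (W *m A *m W ^t*) <-> posdefmx A.
Proof.
move=> uW; split; last exact: posdef_congr.
move=> /(posdef_congr (W := invmx W)); rewrite unitmx_inv => /(_ uW).
by rewrite !mulmxA (mulVmx uW) mul1mx -mulmxA -adjmxM (mulVmx uW) adjmx1 mulmx1.
Qed.

Lemma quad_block m n (X : 'M[C]_m) (Y : 'M[C]_n) (v : 'cV[C]_m) (w : 'cV[C]_n) :
  (col_mx v w) ^t* *m block_mx X 0 0 Y *m col_mx v w =
  v ^t* *m X *m v + w ^t* *m Y *m w.
Proof.
by rewrite adjmx_col mul_row_block !mulmx0 addr0 add0r mul_row_col.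
Qed.

Lemma posdef_block m n (X : 'M[C]_m) (Y : 'M[C]_n) :
  posdefmx (block_mx X 0 0 Y) <-> posdefmx X /\ posdefmx Y.
Proof.
split=> [[h p]|[[hX pX] [hY pY]]].
  have := h; rewrite adjmx_block !adjmx0 => /eq_block_mx[hX _ _ hY].
  split; split => // v v0.
    have := p (col_mx v 0); rewrite quad_block mulmx0 addr0; apply.
    by rewrite col_mx_eq0 negb_and v0.
  have := p (col_mx 0 v); rewrite quad_block mulmx0 add0r; apply.
  by rewrite col_mx_eq0 negb_and v0 orbT.
split; first by rewrite adjmx_block !adjmx0 hX hY.
move=> v; rewrite -[v]vsubmxK col_mx_eq0 quad_block mxE.
have pX' (w : 'cV[C]_m) : 0 <= (w ^t* *m X *m w) 0 0.
  by have [->|w0] := eqVneq w 0; [rewrite mulmx0 mxE|exact: ltW (pX w w0)].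
have pY' (w : 'cV[C]_n) : 0 <= (w ^t* *m Y *m w) 0 0.
  by have [->|w0] := eqVneq w 0; [rewrite mulmx0 mxE|exact: ltW (pY w w0)].
by rewrite negb_and => /orP[/pX h|/pY h]; [apply: ltr_pwDl|apply: ltr_wpDl].
Qed.

Lemma posdef_scalar1 (c : C) : posdefmx (c%:M : 'M[C]_1) <-> 0 < c.
Proof.
split=> [[_ p]|c0].
  have /p : (1%:M : 'cV[C]_1) != 0 by exact: oner_neq0.
  by rewrite adjmx1 mul1mx mulmx1 mxE eqxx.
have cR : c \is Num.real by exact: gtr0_real.
split; first by rewrite adjmx_scalar (CrealP cR).
move=> v v0; rewrite -mulmxA mul_scalar_mx -scalemxAr mxE mulr_gt0//.
rewrite mxE big_ord1 !mxE mulrC -normCK exprn_gt0// normr_gt0.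
by apply: contraNneq v0 => h; apply/eqP/matrixP => i j; rewrite !ord1 h mxE.
Qed.

Lemma det_unipotent_l m n (Z : 'M[C]_(n, m)) :
  \det (block_mx 1%:M 0 Z 1%:M : 'M[C]_(m + n)) = 1.
Proof. by rewrite det_lblock !det1 mulr1. Qed.

Lemma det_unipotent_u m n (Z : 'M[C]_(m, n)) :
  \det (block_mx 1%:M Z 0 1%:M : 'M[C]_(m + n)) = 1.
Proof. by rewrite det_ublock !det1 mulr1. Qed.

Section Schur_complement.
Context {m n : nat} (X : 'M[C]_m) (Y : 'M[C]_(m, n)).

Let K (D : 'M[C]_n) := block_mx X Y (Y ^t*) D.

Let Schur_ur c : 0 < c ->
  let W := block_mx 1%:M (- (c^-1 *: Y)) 0 1%:M in
  W *m K c%:M *m W ^t* = block_mx (X - c^-1 *: (Y *m Y ^t*)) 0 0 c%:M.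
Proof.
move=> cp W; have c0 : c != 0 by rewrite gt_eqF.
rewrite /W adjmx_block !adjmx1 adjmx0 adjmxN adjmxZ conj_invr//.
rewrite /K !mulmx_block !(mulmx1, mul1mx, mul0mx, mulmx0, add0r, addr0).
rewrite !mulNmx -!scalemxAl mul_mx_scalar scalerA mulVf// scale1r subrr.
rewrite mul0mx addr0 mul_scalar_mx scalerN scalerA mulfV// scale1r subrr.
by [].
Qed.

(** Congruence by a unipotent block matrix clears the off-diagonal blocks. The lower right block is
    a scalar matrix, as produced by one new column, so inverting it is a mere scaling. *)
Lemma posdef_Schur c : 0 < c ->
  posdefmx (K c%:M) <-> posdefmx (X - c^-1 *: (Y *m Y ^t*)) /\ posdefmx (c%:M : 'M[C]_n).
Proof.
move=> c0.
pose W := block_mx 1%:M (- (c^-1 *: Y)) 0 1%:M : 'M[C]_(m + n).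
have uW : W \in unitmx by rewrite unitmxE det_unipotent_u unitr1.
by rewrite -(posdef_congrE _ uW) Schur_ur// posdef_block.
Qed.

Lemma det_Schur c : 0 < c ->
  \det (K c%:M) = c ^+ n * \det (X - c^-1 *: (Y *m Y ^t*)).
Proof.
move=> c0; have := congr1 determinant (Schur_ur c0).
by rewrite !det_mulmx det_adjmx det_unipotent_u rmorph1 mul1r mulr1 det_ublock det_scalar mulrC => ->.
Qed.

End Schur_complement.

(** The same elimination from the top left corner. It drives the recursion in [cholesky] and
    supplies the second Schur complement in [posdef_ball]. *)
Lemma posdef_Schur_ul n (c : C) (r : 'cV[C]_n) (D : 'M[C]_n) : 0 < c ->
  let A := block_mx c%:M (r ^t*) r D : 'M[C]_(1 + n) in
  (posdefmx A <-> posdefmx (D - c^-1 *: (r *m r ^t*))) /\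
  \det A = c * \det (D - c^-1 *: (r *m r ^t*)).
Proof.
move=> c0 A.
have cn0 : c != 0 by rewrite gt_eqF.
pose W := block_mx 1%:M 0 (- (c^-1 *: r)) 1%:M : 'M[C]_(1 + n).
have uW : W \in unitmx by rewrite unitmxE det_unipotent_l unitr1.
have WE : W *m A *m W ^t* = block_mx c%:M 0 0 (D - c^-1 *: (r *m r ^t*)).
  rewrite /W adjmx_block !adjmx1 adjmx0 adjmxN adjmxZ conj_invr//.
  rewrite /A !mulmx_block !(mulmx1, mul1mx, mul0mx, mulmx0, add0r, addr0).
  rewrite !mulNmx -!scalemxAl mul_mx_scalar scalerA mulVf// scale1r addNr.
  rewrite mul0mx add0r mul_scalar_mx scalerN scalerA mulfV// scale1r addNr.
  by rewrite [_ + D]addrC.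
split.
  rewrite -(posdef_congrE _ uW) WE posdef_block posdef_scalar1.
  by split => [[]|].
have := congr1 determinant WE.
by rewrite !det_mulmx det_adjmx det_unipotent_l rmorph1 mul1r mulr1 det_ublock det_scalar expr1 => ->.
Qed.

End PositiveDefinite.

(** * Triangular factors and their Jacobians *)

Section Cholesky.
Context {R : realType}.
Local Notation C := R[i].

Lemma real_complex_gt0 (c : C) : 0 < c -> c = (complex.Re c)%:C /\ 0 < complex.Re c.
Proof.
by case: c => a b; rewrite ltcE /= => /andP[/eqP b0 a0]; split=> //; apply/eqP; rewrite eq_complex /= b0 !eqxx.
Qed.

Lemma posdef_decomp n (A : 'M[C]_(1 + n)) : posdefmx A ->
  exists (a : R) (r : 'cV[C]_n) (D : 'M[C]_n),
    0 < a /\ A = block_mx (a%:C)%:M (r ^t*) r D.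
Proof.
move=> [hA pA]; have := hA.
rewrite -[A]submxK adjmx_block => /eq_block_mx[h1 h2 h3 h4].
have e0 : (delta_mx 0 0 : 'cV[C]_(1 + n)) != 0.
  by apply/eqP => /matrixP/(_ 0 0)/eqP; rewrite !mxE eqxx oner_eq0.
have := pA _ e0.
rewrite (_ : (_ *m _ *m _) 0 0 = ulsubmx A 0 0); last first.
  rewrite -mulmxA -colE mxE (bigD1 0)//= big1 ?addr0.
    by rewrite !mxE eqxx rmorph1 mul1r; congr (A _ _); apply: val_inj.
  by move=> i i0; rewrite !mxE (negPf i0) rmorph0 mul0r.
move=> /real_complex_gt0[aE a0].
exists (complex.Re (ulsubmx A 0 0)), (dlsubmx A), (drsubmx A); split => //.
by rewrite -aE -mx11_scalar h2.
Qed.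

(** The first coordinate is eliminated and the Schur complement [D - r r^* / a] is factored
    recursively. Triangularity reduces [v -> L v] to one scaling and one translation per coordinate,
    whence the Jacobian [|det L|^2 = det A]. Of the shape of [L] only the first row is recorded,
    which is what [adapted_factor] uses; its index is compared in [nat] because [n] may be zero. *)
Lemma cholesky n (A : 'M[C]_n) : posdefmx A ->
  0 < \det A /\
  exists L : 'M[C]_n,
  [/\ L *m L ^t* = A,
      forall i j : 'I_n, i = 0%N :> nat -> j != i -> L i j = 0 &
      forall F, (forall v, 0 <= F v)%E -> vfunctional F ->
        vint F = ((complex.Re (\det A))%:E * vint (fun v => F (L *m v)))%E].
Proof.
elim: n A => [|n IH] A.
  rewrite det_mx00 => _; split; first exact: ltr01.
  exists 0; split=> [|[]//|F F0 mF /=]; first by apply/matrixP => -[].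
  by rewrite mul1e mulmx0.
move=> pA; have [a [r [D [a0 AE]]]] := posdef_decomp pA.
have aC0 : 0 < a%:C by rewrite -[0]/(0%:C) ltcR.
have := posdef_Schur_ul r D aC0; rewrite -AE.
set S := D - _ => -[[/(_ pA) pS _] detA].
have [detS [L [LL L0 JL]]] := IH _ pS.
have [dE d0] := real_complex_gt0 detS.
split; first by rewrite detA mulr_gt0.
pose q := Num.sqrt a; have q0 : 0 < q by rewrite sqrtr_gt0.
have qq : q ^+ 2 = a by rewrite sqr_sqrtr ?ltW.
pose L' : 'M[C]_(1 + n) := block_mx (q%:C)%:M 0 ((q^-1)%:C *: r) L.
have LL' : L' *m L' ^t* = A.
  rewrite /L' adjmx_block adjmx0 adjmx_scalar adjmxZ.
  have conjR (x : R) : Num.conj x%:C = x%:C by exact: conjc_real.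
  rewrite !conjR mulmx_block !(mul0mx, mulmx0, addr0) AE.
  rewrite -scalar_mxM -rmorphM -expr2 qq mul_scalar_mx mul_mx_scalar !scalerA -!rmorphM.
  rewrite mulfV ?gt_eqF// !scale1r LL /S.
  rewrite -scalemxAl -scalemxAr scalerA -rmorphM -invfM -expr2 qq.
  by rewrite -fmorphV/= addrC subrK.
exists L'; split; first exact: LL'.
- move=> i j i0 ji; rewrite /L' /block_mx mxE.
  case: splitP => [i' _|k ik]; last by rewrite i0 in ik.
  rewrite mxE; case: splitP => [j' jj|k _]; last by rewrite mxE.
  by case/eqP: ji; apply: val_inj; rewrite /= i0 jj ord1.
move=> F F0 mF.
have mC z : vfunctional (fun v : 'cV_n => F (col_mx z%:M v)) by exact: vfunctional_col.
rewrite /= (cint_scale q0); last 2 first.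
- by move=> z; exact: vint_ge0.
- exact: cfunctional_vint.
rewrite qq detA dE -rmorphM /= EFinM -muleA; congr (_ * _)%E.
have mL : vfunctional (fun v : 'cV_n.+1 => F (L' *m v)).
  move=> d T v mv; apply: mF.
  by apply: mxmeasurable_mul mv; exact: mxmeasurable_cst.
rewrite -cintZl; last 3 first.
- by rewrite lee_fin ltW.
- by move=> z; exact: vint_ge0.
- exact: (cfunctional_vint _ mL).
apply: eq_cint => z.
(* The lower block of [L' (z, v)] is [L v] plus [z q^-1 r]. With [z] fixed this last term is a
   constant shift, introduced before [JL] is applied. *)
rewrite -(@vint_translate _ _ (z *: ((q^-1)%:C *: r)) (fun v => F (col_mx (q%:C * z)%:M v)))//.
rewrite JL//; last first.
  move=> d T v mv; apply: mC; apply: mxmeasurableD => //; exact: mxmeasurable_cst.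
congr (_ * _)%E; apply: eq_vint => v; congr F.
rewrite [RHS](@mul_block_col _ 1 n 1 n 1) mul0mx addr0 mul_mx_scalar scale_scalar_mx.
by rewrite mul_mx_scalar [in RHS]addrC mulrC.
Qed.

(* The factor B is obtained from the Cholesky factor of W A W^*, where the first row
   of the unipotent matrix W is e: since det W = 1, both factors have the same
   Jacobian. *)
Lemma adapted_factor n (A : 'M[C]_(1 + n)) (l : 'rV[C]_n) : posdefmx A ->
  let e := row_mx 1%:M l in
  exists (B : 'M[C]_(1 + n)) (beta : C),
  [/\ B *m B ^t* = A,
      e *m B = row_mx beta%:M 0, sqmod beta = complex.Re ((e *m A *m e ^t*) 0 0) &
      forall F : 'cV[C]_(1 + n) -> \bar R, (forall v, 0 <= F v)%E -> vfunctional F ->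
        vint F = ((complex.Re (\det A))%:E * vint (fun v : 'cV[C]_(1 + n) => F (B *m v)%R))%E].
Proof.
move=> pA e.
pose W := block_mx 1%:M l 0 1%:M : 'M[C]_(1 + n).
pose V := block_mx 1%:M (- l) 0 1%:M : 'M[C]_(1 + n).
have WV : W *m V = 1%:M.
  rewrite /W /V mulmx_block !(mulmx1, mul1mx, mul0mx, mulmx0, add0r, addr0) addNr.
  by rewrite -scalar_mx_block.
have VW : V *m W = 1%:M by exact: mulmx1C.
have detW : \det W = 1 by exact: det_unipotent_u.
have uW : W \in unitmx by rewrite unitmxE detW unitr1.
have [_ [L [LL L0 JL]]] := cholesky (posdef_congr uW pA).
have detE : \det (W *m A *m W ^t*) = \det A.
  by rewrite !det_mulmx det_adjmx detW rmorph1 mul1r mulr1.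
have eW : e = usubmx W by rewrite /W block_mxEv col_mxKu.
pose L' : 'M[C]_(1 + n) := L.
(* [e] is the first row of [W], so [e V] is the first unit row and [e V L] is the first row of [L],
   which has a single nonzero entry at most. *)
have eVL : e *m (V *m L') = row_mx (L' 0 0)%:M 0.
  rewrite mulmxA eW !mul_usub_mx WV mul1mx.
  apply/matrixP => i j; rewrite !ord1 mxE [RHS]mxE; case: splitP => [j' jj|k jk].
    rewrite ord1 mxE eqxx; congr (L _ _); apply: val_inj => //.
    by rewrite /= jj ord1.
  rewrite mxE; apply: L0 => //; apply/eqP => /(congr1 val) /=.
  by rewrite jk.
have BB : (V *m L') *m (V *m L') ^t* = A.
  rewrite adjmxM mulmxA -[V *m L' *m _]mulmxA LL !mulmxA VW mul1mx -mulmxA.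
  by rewrite -adjmxM VW adjmx1 mulmx1.
exists (V *m L'), (L' 0 0); split; [exact: BB|exact: eVL| |].
  rewrite -BB mulmxA -mulmxA -adjmxM eVL adjmx_row mul_row_col mul0mx addr0.
  by rewrite adjmx_scalar -scalar_mxM mxE eqxx mulr1n -sqmodE.
move=> F F0 mF.
have mV : vfunctional (fun v : 'cV[C]_(1 + n) => F (V *m v)).
  by move=> d T v mv; apply: mF; apply: mxmeasurable_mul mv; exact: mxmeasurable_cst.
have mH (G : 'cV[C]_(1 + n) -> \bar R) : vfunctional G -> forall d (T : measurableType d) f (v : T -> 'cV[C]_n),
    cmeasurable f -> mxmeasurable v ->
    measurable_fun setT (fun t => G (col_mx (f t)%:M (v t))).
  by move=> mG d T f v mf mv; apply: mG; exact: mxmeasurable_cons.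
have Vcol z (v : 'cV[C]_n) : V *m col_mx z%:M v = col_mx (z - (l *m v) 0 0)%:M v.
  rewrite /V mul_block_col !(mul1mx, mul0mx, add0r); congr col_mx.
  by rewrite mulNmx raddfB /= -mx11_scalar.
(* [V] shifts the first coordinate by [- l v], a constant once the other coordinates are fixed.
   Integrating that coordinate innermost shows that [V] preserves the integral. *)
transitivity (vint (fun v : 'cV[C]_(1 + n) => F (V *m v))).
  transitivity (vint (fun v => cint (fun z => F (col_mx z%:M v)))).
    exact: (@vint_cint _ _ (fun z v => F (col_mx z%:M v)) _ (mH _ mF)).
  transitivity (vint (fun v => cint (fun z => F (V *m col_mx z%:M v)))); last first.
    by rewrite -(@vint_cint _ _ (fun z v => F (V *m col_mx z%:M v)) _ (mH _ mV)).
  apply: eq_vint => v.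
  rewrite -(@cint_translate _ (- (l *m v) 0 0) (fun z => F (col_mx z%:M v))); last 2 first.
  - by move=> z; exact: F0.
  - by move=> d T f mf; apply: mH => //; exact: mxmeasurable_cst.
  by apply: eq_cint => z; rewrite Vcol.
have -> : (fun v => F (V *m L' *m v)) = (fun v => F (V *m (L' *m v))).
  by apply/funext => v; rewrite mulmxA.
have := JL _ (fun v => F0 (V *m v)) mV.
by rewrite detE.
Qed.

End Cholesky.

(** * Integrating out one column *)

Section Gram.
Context {R : realType}.
Local Notation C := R[i].

Lemma quad_sqnorm n (v : 'cV[C]_n) : (v ^t* *m v) 0 0 = (sqnorm v)%:C.
Proof.
rewrite mxE /sqnorm rmorph_sum; apply: eq_bigr => i _.
by rewrite [RHS]sqmodE !mxE mulrC.
Qed.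

Lemma sqmod_gt0 (z : C) : (0 < sqmod z) = (z != 0).
Proof.
rewrite lt_neqAle sqmod_ge0 andbT eq_sym; congr (~~ _).
by rewrite -(inj_eq (@complexI R)) sqmodE mulf_eq0 conjC_eq0 orbb.
Qed.

Lemma sqnorm_gt0 n (v : 'cV[C]_n) : v != 0 -> 0 < sqnorm v.
Proof.
move=> v0; rewrite lt_neqAle sqnorm_ge0 andbT eq_sym.
apply: contraNneq v0 => /eqP; rewrite psumr_eq0; last by move=> i _; exact: sqmod_ge0.
move=> /allP h; apply/eqP/matrixP => i j; rewrite ord1 mxE; apply/eqP.
by have := h i (mem_index_enum _); apply: contraLR; rewrite -sqmod_gt0 => /gt_eqF ->.
Qed.

Lemma posdef_scalar n (c : C) : 0 < c -> posdefmx (c%:M : 'M[C]_n).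
Proof.
move=> c0; split; first by rewrite adjmx_scalar (CrealP (gtr0_real c0)).
move=> v v0; rewrite -mulmxA mul_scalar_mx -scalemxAr mxE mulr_gt0//.
by rewrite quad_sqnorm -[0]/(0%:C) ltcR sqnorm_gt0.
Qed.

(** The matrix with identity diagonal blocks and off-diagonal blocks [v^*] and [v] has two Schur
    complements, [1 - v v^*] and [1 - v^* v]. Each has the determinant of the whole matrix and
    decides its positivity, and the second is the scalar [1 - |v|^2]. *)
Lemma posdef_ball n (v : 'cV[C]_n) :
  (posdefmx (1%:M - v *m v ^t*) <-> sqnorm v < 1) /\
  \det (1%:M - v *m v ^t*) = (1 - sqnorm v)%:C.
Proof.
have := posdef_Schur_ul v 1%:M (@ltr01 C).
have := det_Schur (1%:M : 'M[C]_1) (v ^t*) (@ltr01 C).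
have := posdef_Schur (1%:M : 'M[C]_1) (v ^t*) (@ltr01 C).
rewrite trmxCK !invr1 !scale1r expr1n mul1r => pK dK [pK' dK'].
have vv : 1%:M - v ^t* *m v = (1 - sqnorm v)%:C%:M.
  by apply/matrixP => i j; rewrite !ord1 [LHS]mxE mxE [in X in _ + X]mxE eqxx quad_sqnorm mxE eqxx rmorphB.
split.
  rewrite -pK' pK vv posdef_scalar1 -[0]/(0%:C) ltcR subr_gt0.
  by split=> [[]//|h]; split => //; exact: posdef_scalar ltr01.
by have := dK; rewrite dK' mul1r vv det_scalar expr1.
Qed.

Lemma posdef_rank1 n (X : 'M[C]_n) (u : 'cV[C]_n) (k : C) : 0 <= k ->
  posdefmx (X - k *: (u *m u ^t*)) -> posdefmx X.
Proof.
move=> k0 [h p].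
have kc : Num.conj k = k by apply/CrealP; exact: ger0_real.
split.
  move: h; rewrite adjmxD adjmxN adjmxZ adjmxM trmxCK kc.
  exact: addIr.
move=> v v0; have := p v v0.
rewrite mulmxBr mulmxBl mxE [X in _ + X]mxE subr_gt0; apply: le_lt_trans.
rewrite -scalemxAr -scalemxAl mxE mulr_ge0//.
rewrite (_ : v ^t* *m (u *m u ^t*) *m v = (u ^t* *m v) ^t* *m (u ^t* *m v)); last first.
  by rewrite adjmxM trmxCK !mulmxA.
by rewrite quad_sqnorm -[0]/(0%:C) lecR sqnorm_ge0.
Qed.

Definition gram n (T : 'M[C]_n) : 'M[C]_n := 1%:M - T *m T ^t*.

(** [tue_schur_density] without its Vandermonde factor, which is constant once the spectrum is
    fixed. The exponent is decoupled from the size because it changes as columns are removed. *)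
Definition tdens m n (T : 'M[C]_n) : R :=
  if `[< posdefmx (gram T) >] then complex.Re (\det (gram T)) ^+ m else 0.

Lemma tdens_ge0 m n (T : 'M[C]_n) : 0 <= tdens m T.
Proof.
rewrite /tdens; case: asboolP => // p.
have [dT _] := cholesky p; have [_ d0] := real_complex_gt0 dT.
by rewrite exprn_ge0// ltW.
Qed.

Section Step.
Context {n : nat} (T : 'M[C]_n) (mu : C).
Hypothesis mu1 : sqmod mu < 1.

Let s := 1 - sqmod mu.
Let s0 : 0 < s. Proof. by rewrite subr_gt0. Qed.

Definition add_column (u : 'cV[C]_n) : 'M[C]_(n + 1) := block_mx T u 0 mu%:M.

Let cross (u : 'cV[C]_n) : 'cV[C]_n := - (Num.conj mu *: u).

Let gramE u : gram (add_column u) =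
  block_mx (gram T - u *m u ^t*) (cross u) ((cross u) ^t*) s%:C%:M.
Proof.
rewrite /cross /gram /add_column adjmx_block adjmx0 adjmx_scalar mulmx_block.
rewrite !(mul0mx, mulmx0, add0r, addr0) -scalar_mxM -sqmodE.
rewrite [X in X - _ = _]scalar_mx_block opp_block_mx add_block_mx !add0r.
rewrite opprD addrA mul_mx_scalar adjmxN adjmxZ conjCK mul_scalar_mx.
by rewrite /s rmorphB raddfB.
Qed.

(** The coefficients of [u u^*] combine through [1 + |mu|^2 / s = 1 / s], where [s = 1 - |mu|^2]. *)
Let schurE u : gram T - u *m u ^t* - s%:C^-1 *:
   (cross u *m (cross u) ^t*) =
  gram T - s%:C^-1 *: (u *m u ^t*).
Proof.
rewrite /cross -addrA -opprD adjmxN mulNmx mulmxN opprK adjmxZ conjCK.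
rewrite -scalemxAl -scalemxAr !scalerA -[X in _ - (X + _)]scale1r -scalerDl.
congr (_ - _ *: _).
have sn0 : s%:C != 0 by rewrite -[0]/(0%:C) (inj_eq (@complexI R)) gt_eqF.
rewrite -mulrA -{1}(mulVf sn0) [_ * mu]mulrC -sqmodE -mulrDr -rmorphD subrK.
by rewrite rmorph1 mulr1.
Qed.

Lemma posdef_add_column u :
  posdefmx (gram (add_column u)) <-> posdefmx (gram T - s%:C^-1 *: (u *m u ^t*)).
Proof.
have sC : 0 < s%:C by rewrite -[0]/(0%:C) ltcR.
have := posdef_Schur (gram T - u *m u ^t*) (cross u) sC.
rewrite schurE -gramE => h; split => [/h[]//|p]; apply/h; split => //.
exact: posdef_scalar.
Qed.

Lemma det_add_column u :
  \det (gram (add_column u)) = s%:C * \det (gram T - s%:C^-1 *: (u *m u ^t*)).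
Proof.
have sC : 0 < s%:C by rewrite -[0]/(0%:C) ltcR.
have := det_Schur (gram T - u *m u ^t*) (cross u) sC.
by rewrite schurE -gramE expr1.
Qed.

Lemma posdef_add_columnW u : posdefmx (gram (add_column u)) -> posdefmx (gram T).
Proof.
move/posdef_add_column; apply: posdef_rank1.
by rewrite invr_ge0 -[0]/(0%:C) lecR ltW.
Qed.

Context (B : 'M[C]_n) (BB : B *m B ^t* = gram T).
Hypothesis detT : 0 < \det (gram T).

Let resc (v : 'cV[C]_n) : 'cV[C]_n := (Num.sqrt s)%:C *: (B *m v).

Let rescaled v : gram T - s%:C^-1 *: (resc v *m (resc v) ^t*) =
  B *m (1%:M - v *m v ^t*) *m B ^t*.
Proof.
rewrite /resc mulmxBr mulmx1 mulmxBl BB adjmxZ adjmxM; congr (_ - _).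
rewrite -scalemxAl -scalemxAr !scalerA (_ : _ * _ = 1) ?scale1r ?mulmxA//.
rewrite (_ : Num.conj (Num.sqrt s)%:C = (Num.sqrt s)%:C); last exact: conjc_real.
by rewrite -fmorphV -!rmorphM -mulrA -expr2 sqr_sqrtr ?ltW// mulVf ?gt_eqF.
Qed.

Let unitB : B \in unitmx.
Proof.
rewrite unitmxE unitfE; apply/eqP => h.
by move: detT; rewrite -BB det_mulmx h mul0r ltxx.
Qed.

Lemma posdef_rescaled v : posdefmx (gram (add_column ((Num.sqrt s)%:C *: (B *m v))))
  <-> sqnorm v < 1.
Proof.
by rewrite posdef_add_column rescaled posdef_congrE// (proj1 (posdef_ball v)).
Qed.

Lemma det_rescaled v : complex.Re (\det (gram (add_column ((Num.sqrt s)%:C *: (B *m v)))))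
  = s * complex.Re (\det (gram T)) * (1 - sqnorm v).
Proof.
rewrite det_add_column rescaled !det_mulmx (proj2 (posdef_ball v)).
rewrite [_ * \det (B ^t*)]mulrAC -det_mulmx BB.
have [-> _] := real_complex_gt0 detT.
by rewrite -!rmorphM /= mulrA.
Qed.

Lemma tdens_rescaled m v : tdens m (add_column ((Num.sqrt s)%:C *: (B *m v))) =
  (s * complex.Re (\det (gram T))) ^+ m * pospow m (1 - sqnorm v).
Proof.
rewrite /tdens /pospow det_rescaled subr_gt0; case: asboolP => [/posdef_rescaled ->|h].
  by rewrite exprMn.
by case: ifP => [/posdef_rescaled//|_]; rewrite mulr0.
Qed.

Lemma rescale_surj (u : 'cV[C]_n) : exists v : 'cV[C]_n, u = (Num.sqrt s)%:C *: (B *m v).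
Proof.
exists ((Num.sqrt s)^-1%:C *: (invmx B *m u)).
rewrite -scalemxAr scalerA -rmorphM mulfV ?gt_eqF ?sqrtr_gt0// rmorph1 scale1r.
by rewrite mulmxA mulmxV// mul1mx.
Qed.

Lemma posdef_add_column_det u : posdefmx (gram (add_column u)) <->
  0 < complex.Re (\det (gram (add_column u))).
Proof.
have [v ->] := rescale_surj u; rewrite posdef_rescaled det_rescaled.
have [_ d0] := real_complex_gt0 detT.
by rewrite pmulr_rgt0 ?subr_gt0// mulr_gt0.
Qed.

End Step.

(** One step of Sylvester's criterion. Once [gram T] is positive definite, in the coordinate [v]
    with [u = sqrt s B v] both the positivity of the enlarged matrix and that of its determinant say
    [|v| < 1]. *)
Lemma posdef_gram_add_column n (T : 'M[C]_n) (mu : C) u : sqmod mu < 1 ->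
  posdefmx (gram (add_column T mu u)) <->
  posdefmx (gram T) /\ 0 < complex.Re (\det (gram (add_column T mu u))).
Proof.
move=> mu1; split=> [h|[pT h]].
  have pT := posdef_add_columnW mu1 h; split => //.
  have [dT [B [BB _ _]]] := cholesky pT.
  exact/(posdef_add_column_det mu1 BB dT).
have [dT [B [BB _ _]]] := cholesky pT.
exact/(posdef_add_column_det mu1 BB dT).
Qed.

End Gram.

Section Column.
Context {R : realType}.
Local Notation C := R[i].
Local Notation mu := (@lebesgue_measure R).

(* The expectation of g under the density k (1 - y)^(k - 1) on (0, 1): the upper
   end of the interval is enforced by pospow, which vanishes for y >= 1. *)
Definition bint k (g : R -> \bar R) : \bar R :=
  (\int[mu]_(y in `[0%R, +oo[) (g y * (k%:R * pospow k.-1 (1 - y))%:E))%E.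

Definition rowsq n (e : 'rV[C]_n) : R := \sum_j sqmod (e 0 j).

Lemma rowsqE n (e : 'rV[C]_n) : (e *m e ^t*) 0 0 = (rowsq e)%:C.
Proof.
rewrite mxE /rowsq rmorph_sum; apply: eq_bigr => i _.
by rewrite [RHS]sqmodE !mxE.
Qed.

Lemma sqmodV (z : C) : sqmod z^-1 = (sqmod z)^-1.
Proof.
have [->|z0] := eqVneq z 0; first by rewrite invr0 /sqmod /= expr0n addr0 invr0.
have s0 : sqmod z != 0 by rewrite gt_eqF// sqmod_gt0.
by apply: (mulIf s0); rewrite -sqmodM !mulVf// -[1]/(1%:C) sqmod_real expr1n.
Qed.

Section Key.
Context {n m : nat} (T : 'M[C]_(1 + n)) (lam nu : C) (l : 'rV[C]_n).
Hypothesis nu1 : sqmod nu < 1.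

Let e : 'rV[C]_(1 + n) := row_mx 1%:M l.
Hypothesis eT : e *m T = lam *: e.

Definition overlap_coef (a b : C) : R := (1 - sqmod a) * (1 - sqmod b) / sqmod (a - b).

(** In the power of [1 - |nu|^2], the exponent [1 + n] is the Jacobian of the scaling by [sqrt s]
    and [m] comes from the determinant. The factor [ball_volume] is left by the coordinates of [v]
    after the first, [disc_area] by the phase of the first, and the last factor offsets the
    normalization inside [bint]. *)
Definition column_const : \bar R :=
  ((1 - sqmod nu) ^+ (1 + n + m))%:E * (ball_volume (R := R) n m *
   (disc_area (R := R))%:E * ((m + n).+1%:R^-1)%:E).

Context (f : R -> \bar R) (mf : measurable_fun setT f).
Hypothesis f0 : forall x, (0 <= f x)%E.

Let F (u : 'cV[C]_(1 + n)) : \bar R :=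
  (f (rowsq e + sqmod ((e *m u) 0%R 0%R / (lam - nu)))%R *
   (tdens m (add_column T nu u))%:E)%E.

Hypothesis mF : vfunctional F.

Let F0 u : (0 <= F u)%E.
Proof.
by rewrite mule_ge0// lee_fin tdens_ge0.
Qed.

Let h (y : R) : \bar R :=
  (f (rowsq e * (1 + overlap_coef lam nu * y))%R * (pospow (m + n) (1 - y))%:E)%E.

Let mfaff (a b : R) : measurable_fun setT (fun y => f (a * (1 + b * y))%R).
Proof.
apply: (measurableT_comp mf); apply: measurable_funM => //.
by apply: measurable_funD => //; exact: measurable_funM.
Qed.

Let mh : measurable_fun setT h.
Proof.
apply: emeasurable_funM; first exact: mfaff.
apply/measurable_EFinP.
by apply: (measurableT_comp (measurable_pospow (m + n))); exact: measurable_funB.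
Qed.

(** Of the powers of [det (gram T)], [m] come from the density and one is the Jacobian of [B]: hence
    [tdens m.+1] on the right. *)
Lemma vint_column :
  vint F = (column_const * ((tdens m.+1 T)%:E *
    bint (m + n).+1 (fun y => f (rowsq e * (1 + overlap_coef lam nu * y))%R)))%E.
Proof.
have s0 : 0 < 1 - sqmod nu by rewrite subr_gt0.
(* If [gram T] is not positive definite, no enlarged Gram matrix is, and both sides vanish. *)
have [pT|npT] := pselect (posdefmx (gram T)); last first.
  rewrite [tdens m.+1 T]/tdens; case: asboolP => // _; rewrite mul0e mule0.
  rewrite -(mul0e (vint F)) -(vintZl (le_refl 0%E) F0 mF); apply: eq_vint => u.
  rewrite mul0e /F /tdens; case: asboolP => [p|_]; last by rewrite mule0.
  by exfalso; apply: npT; exact: posdef_add_columnW p.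
have [dT _] := cholesky pT; have [_ D0] := real_complex_gt0 dT.
have [B [beta [BB eB sqb JB]]] := adapted_factor l pT.
set D := complex.Re _ in D0 JB.
have sqbE : sqmod beta = (1 - sqmod lam) * rowsq e.
  rewrite sqb /gram mulmxBr mulmx1 mulmxBl.
  rewrite (_ : e *m (T *m T ^t*) *m e ^t* = (e *m T) *m (e *m T) ^t*); last first.
    by rewrite adjmxM !mulmxA.
  rewrite eT adjmxZ -scalemxAl -scalemxAr scalerA -sqmodE mxE [X in _ + X]mxE.
  by rewrite [X in _ - X]mxE !rowsqE -rmorphM -rmorphB /=; ring.
have mFB : vfunctional (fun v : 'cV[C]_(1 + n) => F (B *m v)).
  by move=> d T' v mv; apply: mF; apply: mxmeasurable_mul mv; exact: mxmeasurable_cst.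
rewrite (JB _ F0 mF).
rewrite (@vint_scale _ _ (Num.sqrt (1 - sqmod nu)) (fun v : 'cV[C]_(1 + n) => F (B *m v))); last 3 first.
- by rewrite sqrtr_gt0.
- by move=> v; exact: F0.
- exact: mFB.
rewrite -muln2 mulnC exprM sqr_sqrtr ?(ltW s0)//.
have FE z (v : 'cV[C]_n) :
    F (B *m ((Num.sqrt (1 - sqmod nu))%:C *: (col_mx z%:M v : 'cV[C]_(1 + n)))) =
    ((((1 - sqmod nu) * D) ^+ m)%:E *
     (f (rowsq e * (1 + overlap_coef lam nu * sqmod z))%R *
      (pospow m (1 - sqmod z - sqnorm v))%:E))%E.
  rewrite -scalemxAr /F (tdens_rescaled nu1 BB dT) -/D sqnorm_cons.
  rewrite (_ : 1 - (sqmod z + sqnorm v) = 1 - sqmod z - sqnorm v); last by ring.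
  rewrite EFinM muleCA; congr (_ * (f _ * _))%E.
  rewrite -scalemxAr mulmxA eB mul_row_col mul0mx addr0 -scalar_mxM mxE mxE eqxx mulr1n.
  rewrite !sqmodM sqmod_real sqr_sqrtr ?(ltW s0)// sqbE sqmodV /overlap_coef.
  by ring.
have cE : cint (fun z => vint (fun v : 'cV[C]_n =>
    F (B *m ((Num.sqrt (1 - sqmod nu))%:C *: (col_mx z%:M v : 'cV[C]_(1 + n)))))) =
  ((((1 - sqmod nu) * D) ^+ m)%:E * ball_volume n m * cint (fun z => h (sqmod z)))%E.
  rewrite -cintZl; last 3 first.
  - rewrite mule_ge0// ?lee_fin ?exprn_ge0 ?mulr_ge0 ?(ltW s0) ?(ltW D0)// vint_ge0// => v.
    by rewrite lee_fin pospow_ge0.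
  - by move=> z; rewrite mule_ge0// lee_fin pospow_ge0.
  - exact: cfunctional_sqmod.
  apply: eq_cint => z; rewrite (eq_vint (FE z)).
  have mp : vfunctional (fun v : 'cV[C]_n => (pospow m (1 - sqmod z - sqnorm v))%:E).
    apply: (@vfunctional_sqnorm _ _ (fun x => pospow m (1 - sqmod z - x))).
    by apply: measurableT_comp (measurable_pospow m) _; exact: measurable_funB.
  have p0 (v : 'cV[C]_n) : (0 <= (pospow m (1 - sqmod z - sqnorm v))%:E)%E.
    by rewrite lee_fin pospow_ge0.
  rewrite vintZl; last 3 first.
  - by rewrite lee_fin exprn_ge0// mulr_ge0 ?(ltW s0) ?(ltW D0).
  - by move=> v; rewrite mule_ge0.
  - by move=> d T' v mv; apply: emeasurable_funM; [exact: measurable_cst|exact: mp].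
  rewrite vintZl// vint_ball /h [in RHS]muleAC -!muleA; congr (_ * _)%E.
have cE' : vint (fun v : 'cV[C]_(1 + n) => F (B *m ((Num.sqrt (1 - sqmod nu))%:C *: v))) =
  ((((1 - sqmod nu) * D) ^+ m)%:E * ball_volume n m * cint (fun z => h (sqmod z)))%E.
  exact: cE.
rewrite cE' (cint_radial mh); last first.
  by move=> y; rewrite mule_ge0// lee_fin pospow_ge0.
have hE : (\int[mu]_(y in `[0%R, +oo[) h y = (((m + n).+1%:R^-1)%:E *
    bint (m + n).+1 (fun y => f (rowsq e * (1 + overlap_coef lam nu * y))%R)))%E.
  rewrite /bint -ge0_integralZl; last 4 first.
  - exact: measurable_itv.
  - apply: measurable_funTS; apply: emeasurable_funM; first exact: mfaff.
    apply/measurable_EFinP; apply: measurable_funM => //.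
    by apply: (measurableT_comp (measurable_pospow (m + n))); exact: measurable_funB.
  - by move=> y _; rewrite mule_ge0// lee_fin mulr_ge0// pospow_ge0.
  - by rewrite lee_fin invr_ge0.
  by apply: eq_integral => y _; rewrite /h [RHS]muleCA -EFinM mulKf.
rewrite hE /column_const /tdens; case: asboolP => // _; rewrite -/D.
set I := bint _ _; set bv := ball_volume n m.
set da := disc_area%:E%E; set bt := (_.+1%:R^-1)%:E%E.
rewrite -[in RHS]muleA [in RHS](muleCA _ (D ^+ m.+1)%:E%E) !muleA -!EFinM.
congr (_ * _ * _ * _ * _)%E; congr (_%:E).
by rewrite exprMn (exprD (1 - sqmod nu) (1 + n) m) (exprS D m); ring.
Qed.

End Key.

End Column.

(** * Integrating out all columns *)

Section Schur_coordinates.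
Context {R : realType}.
Local Notation C := R[i].
Local Notation mu := (@lebesgue_measure R).
Local Notation I := (nat * nat * bool)%type.
Implicit Types (y : I -> R).

(* The coordinate (i, j, false) is the real part of the entry (i, j), the
   coordinate (i, j, true) its imaginary part. *)
Definition entry y i j : C := y (i, j, false) +i* y (i, j, true).

Definition column_vec n y : 'cV[C]_n := \col_i entry y i n.

Fixpoint column_codes p k n : seq I :=
  if k is k'.+1 then [:: (p, n, false), (p, n, true) & column_codes p.+1 k' n]
  else [::].

(** Columns are listed from left to right, so the last one is integrated innermost and is the first
    to be removed. *)
Fixpoint upper_codes n : seq I :=
  if n is n'.+1 then upper_codes n' ++ column_codes 0 n' n' else [::].

Fixpoint set_column y p n k : 'cV[C]_k -> I -> R :=
  match k with
  | 0 => fun _ => y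
  | k'.+1 => fun u =>
     set_column (upd (upd y (p, n, false) (complex.Re (u 0 0)))
                     (p, n, true) (complex.Im (u 0 0)))
       p.+1 n (dsubmx (u : 'cV_(1 + k')))
  end.

Lemma itint_column (F : (I -> R) -> \bar R) y p n k :
  itint (column_codes p k n) F y = vint (fun u : 'cV[C]_k => F (set_column y p n u)).
Proof.
elim: k p y => [//|k IH] p y /=.
apply: eq_integral => a _; apply: eq_integral => b _.
rewrite IH; apply: eq_vint => v.
have u0 : (col_mx (a +i* b)%:M v : 'cV_k.+1) 0 0 = a +i* b.
  by rewrite mxE; case: splitP => // j _; rewrite !ord1 mxE eqxx.
by rewrite u0 /= (@col_mxKd _ 1 k 1).
Qed.

Lemma set_column_measurable d (T : measurableType d) (phi : T -> I -> R) p n k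
    (u : T -> 'cV[C]_k) :
  (forall i, measurable_fun setT (phi ^~ i)) -> mxmeasurable u ->
  forall i, measurable_fun setT (fun t => set_column (phi t) p n (u t) i).
Proof.
elim: k p phi u => [//|k IH] p phi u mphi mu' i /=.
apply: (IH p.+1 (fun t => upd (upd (phi t) (p, n, false) (complex.Re (u t 0 0)))
                     (p, n, true) (complex.Im (u t 0 0)))
   (fun t => dsubmx (u t : 'cV_(1 + k)))) => [j|j j'].
  have [mu1 mu2] := mu' 0 0.
  by rewrite /upd; case: eqP => // _; case: eqP.
by under eq_fun do rewrite mxE; exact: mu'.
Qed.

Lemma set_column_lt y p n k (u : 'cV[C]_k) i j b : (i < p)%N || (j != n) ->
  set_column y p n u (i, j, b) = y (i, j, b).
Proof.
elim: k p y u => [//|k IH] p y u h /=.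
rewrite IH; last by move: h; case: (j != n); rewrite ?orbT ?orbF// => /ltnW.
rewrite /upd !xpair_eqE; move: h; case: (eqVneq i p) => [->|_] //.
by rewrite ltnn => /negPf -> .
Qed.

Lemma set_column_entry y p n k (u : 'cV[C]_k) (i : 'I_k) :
  entry (set_column y p n u) (p + i) n = u i 0.
Proof.
elim: k p y u i => [|k IH] p y u i; first by case: i.
rewrite /=; case: (unliftP ord0 i) => [i' ->|->].
  rewrite /= /bump /= add1n addnS -addSn IH mxE; congr (u _ _).
  by apply: val_inj.
rewrite addn0 /entry !set_column_lt ?ltnSn//.
by rewrite /upd !xpair_eqE !eqxx /=; case: (u _ _).
Qed.

Section Schur.
Variable lam : nat -> C.

(** Coordinates and eigenvalues are indexed by natural numbers, so that matrices of all sizes read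
    the same [y] and [lam]: the leading block of the next matrix is [schur n y] itself, with no
    change of index type. *)
Definition schur n y : 'M[C]_n :=
  \matrix_(i, j) if i == j then lam i else if (i < j)%N then entry y i j else 0.

Lemma schurS n y : schur (n + 1) y = add_column (schur n y) (lam n) (column_vec n y).
Proof.
apply/matrixP => i j; rewrite /add_column.
case: (split_ordP i) => i' ->; case: (split_ordP j) => j' ->.
- by rewrite block_mxEul !mxE (inj_eq (@lshift_inj _ _)).
- rewrite block_mxEur !mxE eq_lrshift /= ord1 addn0.
  by rewrite ltn_ord.
- rewrite block_mxEdl !mxE eq_rlshift /= ord1 addn0.
  by rewrite ltnNge ltnW.
- by rewrite block_mxEdr !mxE !ord1 !eqxx /= addn0.
Qed.

(* The left eigenvector for lam 0 with first entry 1, one entry at a time. *)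
Fixpoint left_seq n y : seq C :=
  if n is n'.+1 then
    let s := left_seq n' y in
    rcons s (if n' is 0 then 1
             else (\sum_(i < n') s`_i * entry y i n') / (lam 0 - lam n'))
  else [::].

Definition left_vec n y : 'rV[C]_n := \row_j (left_seq n y)`_j.

Lemma size_left_seq n y : size (left_seq n y) = n.
Proof. by elim: n => //= n IH; rewrite size_rcons IH. Qed.

Lemma left_vecS n y : (0 < n)%N -> left_vec (n + 1) y =
  row_mx (left_vec n y) (((left_vec n y *m column_vec n y) 0 0 / (lam 0 - lam n))%:M).
Proof.
move=> n0; apply/matrixP => i j; rewrite ord1.
have E : left_seq (n + 1) y = left_seq n.+1 y by rewrite addn1.
case: (split_ordP j) => j' ->; rewrite ?row_mxEl ?row_mxEr !mxE E /= nth_rcons size_left_seq.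
  by rewrite ltn_ord.
rewrite ord1 /= addn0 ltnn eqxx mulr1n; case: n n0 j j' E => // n _ _ _ _.
congr (_ / _); apply: eq_bigr => k _; by rewrite !mxE.
Qed.

Lemma left_vec0 n y : left_vec n.+1 y 0 0 = 1.
Proof.
rewrite mxE; elim: n => //= n; rewrite !nth_rcons !size_rcons !size_left_seq /=.
by case: n.
Qed.

Lemma left_vec_cons n y : exists l : 'rV[C]_n,
  left_vec n.+1 y = row_mx 1%:M l :> 'rV[C]_(1 + n).
Proof.
exists (rsubmx (left_vec n.+1 y : 'rV_(1 + n))).
rewrite -[LHS](@hsubmxK _ 1 1 n); congr row_mx.
apply/matrixP => i j; rewrite !ord1 !mxE eqxx.
by rewrite -[RHS](left_vec0 n y) mxE; congr nth.
Qed.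

(** With [b] the vector of size [n], [u] the new column and [x] the new entry, the last coordinate
    of the equation is [b u + x lam_n = lam_0 x]. This is the equation that [left_seq] solves for
    [x]. *)
Lemma left_vec_eigen n y : (0 < n)%N -> (forall k, (0 < k < n)%N -> lam 0 != lam k) ->
  left_vec n y *m schur n y = lam 0 *: left_vec n y.
Proof.
elim: n => // n IH _ hlam; case: (posnP n) => [n0|n0].
  rewrite n0; apply/matrixP => i j; rewrite !ord1 !mxE big_ord1 !mxE eqxx /=.
  by rewrite mulrC.
rewrite -[n.+1]addn1 left_vecS// schurS /add_column mul_row_block.
rewrite IH//; last by move=> k /andP[k0 kn]; apply: hlam; rewrite k0 ltnW.
rewrite mulmx0 addr0 scale_row_mx; congr row_mx.
rewrite -scalar_mxM scale_scalar_mx [X in X + _]mx11_scalar -raddfD /=.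
congr (_%:M); set b := (_ *m _) 0 0.
have d0 : lam 0 - lam n != 0 by rewrite subr_eq0 hlam ?n0 /=.
by field.
Qed.

(** For a triangular matrix the right eigenvector of [lam 0] is the first unit vector. It has norm
    one and pairs to one with [left_vec], so the whole overlap is the squared norm of the left
    eigenvector. *)
Definition left_overlap n y : R := rowsq (left_vec n y).

Lemma left_overlapS n y : (0 < n)%N -> left_overlap (n + 1) y = left_overlap n y +
  sqmod ((left_vec n y *m column_vec n y) 0 0 / (lam 0 - lam n)).
Proof.
move=> n0; rewrite /left_overlap left_vecS// /rowsq big_split_ord /= big_ord1.
by congr (_ + _); [apply: eq_bigr => i _; rewrite row_mxEl|rewrite row_mxEr mxE eqxx].
Qed.

Lemma left_overlap1 y : left_overlap 1 y = 1.
Proof. by rewrite /left_overlap /rowsq big_ord1 left_vec0 -[1]/(1%:C) sqmod_real expr1n. Qed.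

End Schur.

End Schur_coordinates.

(** * Iterated averages over beta factors *)

Section Beta_product.
Context {R : realType}.
Local Notation mu := (@lebesgue_measure R).

Lemma bint_ge0 k (g : R -> \bar R) : (forall x, 0 <= g x)%E -> (0 <= bint k g)%E.
Proof.
move=> g0; apply: integral_ge0 => y _; rewrite mule_ge0// lee_fin mulr_ge0//.
exact: pospow_ge0.
Qed.

Lemma measurable_bint d (T : measurableType d) k (g : T -> R -> \bar R) :
  (forall t x, 0 <= g t x)%E ->
  measurable_fun setT (fun p : T * measurableTypeR R => g p.1 p.2) ->
  measurable_fun setT (fun t => bint k (g t)).
Proof.
move=> g0 mg; rewrite /bint.
pose D : set (measurableTypeR R) := `[0, +oo[%classic.
have mD : measurable D by exact: measurable_itv.
under eq_fun do rewrite integral_mkcond.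
pose h (p : T * measurableTypeR R) :=
  (g p.1 p.2 * (k%:R * pospow k.-1 (1 - p.2))%:E * (\1_D p.2)%:E)%E.
rewrite (_ : (fun _ => _) = fubini_F mu h); last first.
  apply/funext => t; apply: eq_integral => y _; rewrite patchE /h /= indicE.
  by case: ifPn => _; rewrite ?mule1 ?mule0.
apply: measurable_fun_fubini_tonelli_F => [|p].
  apply: emeasurable_funM; last first.
    apply: (measurableT_comp (f := fun y : measurableTypeR R => (\1_D y)%:E)); last exact: measurable_snd.
    exact: measurable_indic_EFin.
  apply: emeasurable_funM => //; apply/measurable_EFinP; apply: measurable_funM => //.
  apply: (measurableT_comp (measurable_pospow k.-1)); apply: measurable_funB;
    [exact: measurable_cst|exact: measurable_snd].
by rewrite mule_ge0// ?mule_ge0// lee_fin ?mulr_ge0// pospow_ge0.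
Qed.

(* The expectation of f (\prod_(c <- s) (1 + c * Y_c)) for independent Y_c of
   density k (1 - y)^(k - 1) on (0, 1). *)
Fixpoint beta_prod k (s : seq R) (f : R -> \bar R) : \bar R :=
  if s is c :: s' then
    beta_prod k s' (fun z => bint k (fun y => f (z * (1 + c * y))))
  else f 1.

Lemma measurable_bint_step k c (f : R -> \bar R) : (forall x, 0 <= f x)%E ->
  measurable_fun setT f ->
  measurable_fun setT (fun z : R => bint k (fun y => f (z * (1 + c * y)))).
Proof.
move=> f0 mf.
apply: (@measurable_bint _ (measurableTypeR R) k (fun z y => f (z * (1 + c * y)))) => //.
apply: (measurableT_comp (mf : measurable_fun [set: measurableTypeR R] f)).
apply: measurable_funM; first exact: measurable_fst.
by apply: measurable_funD => //; apply: measurable_funM => //; exact: measurable_snd.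
Qed.

End Beta_product.

(** [k] is an extended real because the constants collected from the columns are not yet known to be
    finite. *)
Lemma itintZl (R : realType) (I : eqType) s (k : \bar R) (F : (I -> R) -> \bar R) y :
  (0 <= k)%E -> (forall z, 0 <= F z)%E -> mfunctional F ->
  itint s (fun z => k * F z)%E y = (k * itint s F y)%E.
Proof.
move=> k0 F0 mF; elim: s y => //= i s IH y.
rewrite -ge0_integralZl//; last 2 first.
- apply: (itint_measurable s F0 mF (phi := fun t : measurableTypeR R => upd y i t)) => j.
  by rewrite /upd; case: eqP.
- by move=> t _; exact: itint_ge0.
by apply: eq_integral => t _; rewrite IH.
Qed.

(** * Integration of the Schur density over all strictly upper entries *)

Section Schur_law.
Context {R : realType}.
Local Notation C := R[i].
Local Notation I := (nat * nat * bool)%type.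
Variable lam : nat -> C.
Hypothesis lam1 : forall k, sqmod (lam k) < 1.

Lemma posdef_schurS n y : posdefmx (gram (schur lam (n + 1) y)) <->
  posdefmx (gram (schur lam n y)) /\ 0 < complex.Re (\det (gram (schur lam (n + 1) y))).
Proof. by rewrite schurS; exact: posdef_gram_add_column. Qed.

Section Measurability.
Context d (T : measurableType d) (phi : T -> I -> R).
Hypothesis mphi : forall i, measurable_fun setT (phi ^~ i).

Lemma cmeasurable_entry i j : cmeasurable (fun t => entry (phi t) i j).
Proof. by split; exact: mphi. Qed.

Lemma mxmeasurable_schur n : mxmeasurable (fun t => schur lam n (phi t)).
Proof.
move=> i j; under eq_fun do rewrite mxE.
case: (i == j); first exact: cmeasurable_cst.
by case: (i < j)%N; [exact: cmeasurable_entry|exact: cmeasurable_cst].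
Qed.

Lemma cmeasurable_left_seq n j : cmeasurable (fun t => (left_seq lam n (phi t))`_j).
Proof.
elim: n j => [|n IH] j /=.
  by under eq_fun do rewrite nth_nil; exact: cmeasurable_cst.
under eq_fun do rewrite nth_rcons size_left_seq.
case: (j < n)%N; first exact: IH.
case: (j == n); last exact: cmeasurable_cst.
case: n IH => [|n] IH; first exact: cmeasurable_cst.
apply: cmeasurableM; last exact: cmeasurable_cst.
by apply: cmeasurable_sum => i; apply: cmeasurableM; [exact: IH|exact: cmeasurable_entry].
Qed.

Lemma measurable_left_overlap n : measurable_fun setT (fun t => left_overlap lam n (phi t)).
Proof.
apply: measurable_sum => j; apply: measurable_sqmod.
by under eq_fun do rewrite mxE; exact: cmeasurable_left_seq.
Qed.

Lemma measurable_det_gram n :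
  measurable_fun setT (fun t => complex.Re (\det (gram (schur lam n (phi t))))).
Proof.
have : cmeasurable (fun t => \det (gram (schur lam n (phi t)))); last by case.
apply: cmeasurable_det; rewrite /gram; apply: mxmeasurableD; first exact: mxmeasurable_cst.
apply: mxmeasurableN; apply: mxmeasurable_mul; first exact: mxmeasurable_schur.
exact/mxmeasurable_adj/mxmeasurable_schur.
Qed.

(* Positive definiteness of the Gram matrices is decided by the signs of the nested
   determinants, which are polynomials in the coordinates. *)
Lemma measurable_posdef n :
  measurable_fun setT (fun t => `[< posdefmx (gram (schur lam n (phi t))) >]).
Proof.
elim: n => [|n IH].
  rewrite (_ : (fun _ => _) = cst true); first exact: measurable_cst.
  apply/funext => t; apply/asboolP; split; first by apply/matrixP => -[].
  by move=> v; rewrite [v]flatmx0 eqxx.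
rewrite -[n.+1]addn1.
rewrite (_ : (fun _ => _) = (fun t => `[< posdefmx (gram (schur lam n (phi t))) >] &&
  (0 < complex.Re (\det (gram (schur lam (n + 1) (phi t))))))).
  apply: measurable_and => //; apply: measurable_fun_ltr => //.
  exact: measurable_det_gram.
apply/funext => t; apply/idP/andP => [/asboolP/posdef_schurS[p h]|[/asboolP p h]].
  by split => //; exact/asboolP.
by apply/asboolP/posdef_schurS.
Qed.

Lemma measurable_tdens m n : measurable_fun setT (fun t => tdens m (schur lam n (phi t))).
Proof.
apply: measurable_fun_ifT; first exact: measurable_posdef.
- apply: measurable_funX; exact: measurable_det_gram.
- exact: measurable_cst.
Qed.

End Measurability.

Lemma mfunctional_density (f : R -> \bar R) m n : measurable_fun setT f ->
  mfunctional (fun y : I -> R => f (left_overlap lam n y) * (tdens m (schur lam n y))%:E)%E.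
Proof.
move=> mf d T phi mphi; apply: emeasurable_funM.
  apply: (measurableT_comp mf); exact: measurable_left_overlap.
by apply/measurable_EFinP; exact: measurable_tdens.
Qed.

Lemma eq_schur n (y y' : I -> R) :
  (forall i j b, (i < j < n)%N -> y (i, j, b) = y' (i, j, b)) ->
  schur lam n y = schur lam n y' /\ left_seq lam n y = left_seq lam n y'.
Proof.
move=> yy; split.
  apply/matrixP => i j; rewrite !mxE; case: (i == j) => //; case: ifP => // ij.
  by rewrite /entry !yy ?ij/=.
elim: n yy => //= n IH yy; rewrite IH; last first.
  by move=> i j b /andP[ij jn]; rewrite yy// ij ltnW.
congr rcons; case: n IH yy => // n _ yy; congr (_ / _); apply: eq_bigr => i _.
by rewrite /entry !yy ?ltn_ord/=.
Qed.

(** [K] is chosen before [f], so that a single test function can identify it later. The coefficients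
    appear in decreasing order because the last column goes first, and the parameter [m + n] of the
    beta factors is the same at every step. *)
Lemma itint_schur n m : (forall k, (0 < k <= n)%N -> lam 0 != lam k) ->
  exists2 K : \bar R, (0 <= K)%E & forall (f : R -> \bar R) (y : I -> R),
    (forall x, 0 <= f x)%E -> measurable_fun setT f ->
  itint (upper_codes n.+1) (fun y => f (left_overlap lam n.+1 y) * (tdens m (schur lam n.+1 y))%:E)%E y =
  (K * beta_prod (m + n) [seq overlap_coef (lam 0) (lam i) | i <- rev (iota 1 n)] f)%E.
Proof.
elim: n m => [|n IH] m hlam.
  (* A matrix of size one has no entry above the diagonal: the density is a constant, read off at
     any point. *)
  exists (tdens m (schur lam 1 (fun=> 0)))%:E; first by rewrite lee_fin tdens_ge0.
  move=> f y f0 mf; have -> : schur lam 1 (fun=> 0) = schur lam 1 y.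
    by apply/matrixP => i j; rewrite !mxE !ord1.
  transitivity (f (left_overlap lam 1 y) * (tdens m (schur lam 1 y))%:E)%E; first by [].
  by rewrite left_overlap1 muleC.
have [|K K0 KE] := IH m.+1; first by move=> k /andP[k0 kn]; apply: hlam; rewrite k0 ltnW.
have hK : (0 <= column_const (n := n) (m := m) (lam n.+1))%E.
  apply: mule_ge0; first by rewrite lee_fin exprn_ge0// subr_ge0 ltW.
  apply: mule_ge0; last by rewrite lee_fin invr_ge0.
  apply: mule_ge0; last by rewrite lee_fin disc_area_ge0.
  by apply: vint_ge0 => v; rewrite lee_fin pospow_ge0.
exists (column_const (n := n) (m := m) (lam n.+1) * K)%E; first by rewrite mule_ge0.
move=> f y f0 mf.
have -> : upper_codes n.+2 = upper_codes n.+1 ++ column_codes 0 n.+1 n.+1 by [].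
rewrite itint_cat.
pose g z := bint (m + n).+1 (fun y => f (z * (1 + overlap_coef (lam 0) (lam n.+1) * y))%R).
have g0 z : (0 <= g z)%E by exact: bint_ge0.
have mg : measurable_fun setT g.
  exact: measurable_bint_step.
transitivity (itint (upper_codes n.+1) (fun y => column_const (n := n) (m := m) (lam n.+1) *
   (g (left_overlap lam n.+1 y) * (tdens m.+1 (schur lam n.+1 y))%:E))%E y); last first.
  rewrite itintZl//; last 2 first.
  - by move=> z; rewrite mule_ge0// lee_fin tdens_ge0.
  - exact: mfunctional_density.
  rewrite KE// muleA; congr (_ * _)%E.
  have -> : rev (iota 1 n.+1) = n.+1 :: rev (iota 1 n).
    by rewrite -(addn1 n) iotaD rev_cat /= add1n addn1.
  by rewrite addnS.
apply: eq_itint => {}y.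
rewrite itint_column.
have [l lE] := left_vec_cons lam n y.
have eT : left_vec lam n.+1 y *m schur lam n.+1 y = lam 0 *: left_vec lam n.+1 y.
  by apply: left_vec_eigen => // k /andP[k0 kn]; apply: hlam; rewrite k0 ltnW.
have FE (u : 'cV[C]_n.+1) :
    (f (left_overlap lam n.+2 (set_column y 0%N n.+1 u)) *
      (tdens m (schur lam n.+2 (set_column y 0%N n.+1 u)))%:E =
    f (rowsq (left_vec lam n.+1 y) + sqmod ((left_vec lam n.+1 y *m u) 0%R 0%R / (lam 0 - lam n.+1)))%R *
   (tdens m (add_column (schur lam n.+1 y) (lam n.+1) u))%:E)%E.
  set y' := set_column _ _ _ _.
  (* Overwriting the last column changes neither the leading block nor its left eigenvector. *)
  have [SE lE'] : schur lam n.+1 y' = schur lam n.+1 y /\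
      left_seq lam n.+1 y' = left_seq lam n.+1 y.
    by apply: eq_schur => i j b /andP[_ jn]; rewrite /y' set_column_lt// (ltn_eqF jn) orbT.
  have cE : column_vec n.+1 y' = u.
    apply/matrixP => i j; rewrite mxE ord1.
    exact: (set_column_entry y 0 n.+1 u i).
  have lvE : left_vec lam n.+1 y' = left_vec lam n.+1 y.
    by apply/matrixP => i j; rewrite !mxE lE'.
  have tE : tdens m (schur lam n.+2 y') = tdens m (add_column (schur lam n.+1 y) (lam n.+1) u).
    by rewrite -[n.+2]addn1 schurS SE cE.
  have oE : left_overlap lam n.+2 y' = rowsq (left_vec lam n.+1 y) +
      sqmod ((left_vec lam n.+1 y *m u) 0 0 / (lam 0 - lam n.+1)).
    by rewrite -[n.+2]addn1 (left_overlapS _ _ (ltn0Sn n)) /left_overlap lvE cE.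
  by rewrite tE oE.
rewrite (eq_vint FE).
pose e : 'rV[C]_(1 + n) := left_vec lam n.+1 y.
pose S : 'M[C]_(1 + n) := schur lam n.+1 y.
have eE : e = row_mx 1%:M l by exact: lE.
have mF : vfunctional (fun u : 'cV[C]_(1 + n) =>
    f (rowsq e + sqmod ((e *m u) 0%R 0%R / (lam 0 - lam n.+1)))%R *
    (tdens m (add_column S (lam n.+1) u))%:E)%E.
  move=> d T v mv.
  have := @mfunctional_density f m n.+2 mf d T (fun t => set_column y 0%N n.+1 (v t))
    (set_column_measurable 0%N n.+1 (phi := fun=> y) (fun i => measurable_cst _) mv).
  by apply: eq_measurable_fun => t _; exact: FE.
have H := @vint_column R n m S (lam 0) (lam n.+1) l (lam1 n.+1).
rewrite -eE in H; rewrite [LHS](H eT f mf f0 mF).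
by rewrite /g [(_ * bint _ _)%E]muleC.
Qed.

End Schur_law.

(** * The overlap as a squared norm *)

(** By induction on the size, bordering the eigenbasis [L] of the lower block with the row [(1, x)],
    where [x (a - T') = r]. The matrix [a - T'] is invertible because [L] conjugates [T'] to a
    diagonal matrix none of whose entries is [a]. *)
Lemma triangular_eigenbasis (F : fieldType) n (T : 'M[F]_n) :
  (forall i j : 'I_n, (j < i)%N -> T i j = 0) -> injective (fun i => T i i) ->
  exists2 L : 'M[F]_n, L \in unitmx & L *m T = diag_mx (\row_i T i i) *m L.
Proof.
elim: n T => [|n IH] T tT iT.
  by exists 1%:M; [exact: unitmx1|apply/matrixP => -[]].
pose A : 'M[F]_(1 + n) := T.
pose a := T 0 0; pose r := ursubmx A; pose T' := drsubmx A.
have AE : A = block_mx a%:M r 0 T'.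
  rewrite -[LHS]submxK [ulsubmx A]mx11_scalar; congr block_mx.
    by congr (_%:M); rewrite !mxE; congr (T _ _); apply: val_inj.
  by apply/matrixP => i j; rewrite !mxE tT//= ord1.
have T'E i j : T' i j = T (rshift 1 i) (rshift 1 j) by rewrite !mxE.
have [||L uL LT] := IH T'.
- by move=> i j ij; rewrite T'E tT.
- move=> i j; rewrite !T'E => /iT /(congr1 val) /= /eqP.
  by rewrite eqn_add2l => /eqP /val_inj.
pose D := diag_mx (\row_i T' i i).
have uD : a%:M - D \in unitmx.
  rewrite (_ : a%:M - D = diag_mx (\row_i (a - T' i i))); last first.
    by apply/matrixP => i j; rewrite !mxE; case: eqP => _; rewrite ?subrr.
  rewrite unitmxE det_diag unitfE; apply/prodf_neq0 => i _.
  rewrite mxE subr_eq0 T'E; apply/eqP => /iT /(congr1 val) /=.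
  by rewrite add1n.
have uT : a%:M - T' \in unitmx.
  have : L *m (a%:M - T') = (a%:M - D) *m L.
    by rewrite mulmxBr mulmxBl LT mul_mx_scalar mul_scalar_mx.
  move=> h; have : L *m (a%:M - T') \in unitmx by rewrite h unitmx_mul uD uL.
  by rewrite unitmx_mul => /andP[].
pose x := r *m invmx (a%:M - T').
pose V : 'M[F]_(1 + n) := block_mx 1%:M x 0 L.
have uV : V \in unitmx by rewrite unitmxE det_ublock det1 mul1r -unitmxE.
exists V; first exact: uV.
have xE : r + x *m T' = a *: x.
  have : x *m (a%:M - T') = r by rewrite mulmxKV.
  by rewrite mulmxBr mul_mx_scalar => <-; rewrite subrK.
have VA : V *m A = block_mx a%:M 0 0 D *m V.
  rewrite AE /V !mulmx_block !(mul0mx, mulmx0, mulmx1, mul1mx, addr0, add0r) LT.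
  by rewrite xE mul_scalar_mx.
have DE : diag_mx (\row_i A i i) = block_mx a%:M 0 0 D.
  apply/matrixP => i j.
  case: (split_ordP i) => i' ->; case: (split_ordP j) => j' ->.
  - rewrite block_mxEul !mxE !ord1 !eqxx /a; congr (_ *+ _).
    by congr (T _ _); exact: val_inj.
  - by rewrite block_mxEur !mxE eq_lrshift.
  - by rewrite block_mxEdl !mxE eq_rlshift.
  - by rewrite block_mxEdr !mxE (inj_eq (@rshift_inj _ _)).
by rewrite -DE in VA.
Qed.

Section Overlap_value.
Context {R : realType} {N : nat}.
Local Notation C := R[i].
Variables (G T U : 'M[C]_N) (lam : 'I_N -> C) (i : 'I_N) (b : 'rV[C]_N).
Hypotheses (uU : U \is unitarymx) (GE : G = U *m T *m U ^t*).
Hypotheses (tT : forall i j : 'I_N, (j < i)%N -> T i j = 0)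
  (dT : forall i, T i i = lam i) (lam_inj : injective lam).
Hypotheses (Te : T *m delta_mx i 0 = lam i *: (delta_mx i 0 : 'cV_N))
  (bT : b *m T = lam i *: b) (b1 : b 0 i = 1).

Let UU : U ^t* *m U = 1%:M.
Proof. by apply: mulmx1C; apply/unitarymxP. Qed.

Let UU' : U *m U ^t* = 1%:M.
Proof. exact/unitarymxP. Qed.

(** [overlap] selects an eigensystem by [xget]; existence guarantees that the selected pair is not
    the default [(0, 0)]. *)
Lemma eigensystem_exists : exists p : 'M[C]_N * 'M[C]_N,
  biorthogonal_eigensystem G lam p.1 p.2.
Proof.
have [|L uL LT] := triangular_eigenbasis tT.
  by move=> x y; rewrite !dT; exact: lam_inj.
have DE : diag_mx (\row_k T k k) = diag_mx (\row_k lam k).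
  by congr diag_mx; apply/rowP => k; rewrite !mxE dT.
rewrite {}DE in LT; set D := diag_mx _ in LT.
exists (U *m invmx L, L *m U ^t*); split => /= [j|j|].
- have GR : G *m (U *m invmx L) = U *m invmx L *m D.
    rewrite GE mulmxA -[_ *m U ^t* *m U]mulmxA UU mulmx1 -!mulmxA; congr (_ *m _).
    rewrite -[T *m _]mul1mx -(mulVmx uL) -[in LHS]mulmxA; congr (_ *m _).
    by rewrite mulmxA LT mulmxK.
  rewrite [in LHS]colE mulmxA GR -colE mul_mx_diag.
  by apply/colP => k; rewrite !mxE mulrC.
- have GL : L *m U ^t* *m G = D *m (L *m U ^t*).
    by rewrite GE !mulmxA -[L *m _ *m U]mulmxA UU mulmx1 LT.
  rewrite -row_mul GL mul_diag_mx.
  by apply/rowP => k; rewrite !mxE.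
- by rewrite mulmxA -[L *m _ *m _]mulmxA UU mulmx1 mulmxV.
Qed.

(** Simplicity of the spectrum makes the vectors [e] and [c] multiples of the selected [R_i] and
    [L_i], with factors [al] and [ga]. The normalizations [c e = 1] and [L_i R_i = 1] force
    [|ga al| = 1], so the product of squared norms does not depend on the selection, and [|e| = 1]
    leaves that of [c], hence of [b]. *)
Lemma diag_overlapE : diag_overlap G lam i = rowsq b.
Proof.
rewrite /diag_overlap /overlap.
have := xgetPex ((0, 0) : 'M[C]_N * 'M[C]_N) eigensystem_exists.
case: (xget _ _) => Rm Lm [/= GR LG LR].
have RL : Rm *m Lm = 1%:M by exact: (mulmx1C LR).
rewrite quad_sqnorm rowsqE.
pose e : 'cV[C]_N := U *m delta_mx i 0; pose c : 'rV[C]_N := b *m U ^t*.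
have Ge : G *m e = lam i *: e.
  by rewrite /e GE mulmxA -[_ *m U ^t* *m U]mulmxA UU mulmx1 -mulmxA Te scalemxAr.
have cG : c *m G = lam i *: c.
  by rewrite /c GE !mulmxA -[b *m _ *m U]mulmxA UU mulmx1 bT scalemxAl.
have ce : c *m e = 1%:M.
  rewrite /c /e mulmxA -[b *m _ *m U]mulmxA UU mulmx1 -colE.
  by apply/matrixP => x y; rewrite !ord1 !mxE b1.
have e1 : sqnorm e = 1.
  apply: complexI; rewrite -quad_sqnorm /e adjmxM mulmxA -[_ *m U ^t* *m U]mulmxA UU mulmx1.
  by rewrite -colE !mxE !eqxx rmorph1.
have cb : rowsq c = rowsq b.
  by apply: complexI; rewrite -!rowsqE /c adjmxM trmxCK mulmxA -[b *m _ *m U]mulmxA UU mulmx1.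
move: e c Ge cG ce e1 cb => e c Ge cG ce e1 cb.
(* A left and a right eigenvector for distinct eigenvalues are orthogonal; the same holds for
   [cR]. *)
have Le j : j != i -> row j Lm *m e = 0.
  move=> ji; have : (lam j - lam i) *: (row j Lm *m e) = 0.
    by rewrite scalerBl scalemxAl -LG scalemxAr -Ge mulmxA subrr.
  move/eqP; rewrite scaler_eq0 subr_eq0 => /orP[/eqP/lam_inj h|/eqP//].
  by rewrite h eqxx in ji.
have cR j : j != i -> c *m col j Rm = 0.
  move=> ji; have : (lam j - lam i) *: (c *m col j Rm) = 0.
    by rewrite scalerBl scalemxAr -GR scalemxAl -cG mulmxA subrr.
  move/eqP; rewrite scaler_eq0 subr_eq0 => /orP[/eqP/lam_inj h|/eqP//].
  by rewrite h eqxx in ji.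
pose al := (row i Lm *m e) 0 0; pose ga := (c *m col i Rm) 0 0.
have eE : e = al *: col i Rm.
  rewrite -[LHS]mul1mx -RL -mulmxA.
  have -> : Lm *m e = al *: delta_mx i 0.
    apply/colP => j; rewrite [RHS]mxE [X in _ = _ * X]mxE eqxx andbT.
    rewrite (_ : (Lm *m e) j 0 = (row j Lm *m e) 0 0); last by rewrite -row_mul [RHS]mxE.
    by have [->|ji] := eqVneq j i; rewrite ?mulr1// Le// mulr0 mxE.
  by rewrite -scalemxAr -colE.
have cE : c = ga *: row i Lm.
  rewrite -[LHS]mulmx1 -RL mulmxA.
  have -> : c *m Rm = ga *: delta_mx 0 i.
    apply/rowP => j; rewrite [RHS]mxE [X in _ = _ * X]mxE eqxx /=.
    rewrite (_ : (c *m Rm) 0 j = (c *m col j Rm) 0 0); last by rewrite colE mulmxA -colE [RHS]mxE.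
    by have [->|ji] := eqVneq j i; rewrite ?mulr1// cR// mulr0 mxE.
  by rewrite -scalemxAl -rowE.
have ag : sqmod (ga * al) = 1.
  have : row i Lm *m col i Rm = 1%:M.
    rewrite rowE colE mulmxA -[_ *m Lm *m Rm]mulmxA LR mulmx1 mul_delta_mx.
    by apply/matrixP => x y; rewrite !ord1 !mxE.
  move=> h; have := ce; rewrite eE cE -scalemxAl -scalemxAr h => /matrixP/(_ 0 0).
  by rewrite !mxE eqxx !mulr1n mulr1 => ->; rewrite -[1]/(1%:C) sqmod_real expr1n.
have -> : rowsq b = sqmod ga * rowsq (row i Lm).
  by rewrite -cb cE /rowsq mulr_sumr; apply: eq_bigr => j _; rewrite mxE sqmodM.
move: e1; rewrite eE sqnormZ => e1.
by rewrite -rmorphM /= -[RHS]mulr1 -e1 mulrACA -sqmodM ag mul1r.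
Qed.

End Overlap_value.

(** * Products of independent beta variables *)

Section Density.
Context d (T : measurableType d) (R : realType).
Variables (mu nu : {measure set T -> \bar R}) (g : T -> R).
Hypotheses (mg : measurable_fun setT g) (g0 : forall x, 0 <= g x).
Hypothesis nuE : forall A, measurable A -> nu A = (\int[mu]_(x in A) (g x)%:E)%E.

Import HBNNSimple.

Let step (k : {nnsfun T >-> R}) :
  (\int[nu]_x (k x)%:E = \int[mu]_x ((k x)%:E * (g x)%:E))%E.
Proof.
under eq_integral do rewrite fimfunE -fsumEFin//.
rewrite ge0_integral_fsum//; last 2 first.
- by move=> y; exact/measurable_EFinP/measurable_funM.
- by move=> y x _; rewrite nnfun_muleindic_ge0.
under [RHS]eq_integral => x _.
  rewrite fimfunE -fsumEFin// ge0_mule_fsuml; last first.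
    by move=> r; rewrite nnfun_muleindic_ge0.
  over.
rewrite ge0_integral_fsum//; last 2 first.
- move=> y; apply: emeasurable_funM; last exact/measurable_EFinP.
  exact/measurable_EFinP/measurable_funM.
- by move=> y x _; rewrite mule_ge0// ?nnfun_muleindic_ge0// lee_fin.
apply: eq_fsbigr => r; rewrite inE => -[x0 _ <-].
rewrite integralZl_indic_nnsfun// integral_indic// setIT nuE//.
rewrite integral_mkcond -ge0_integralZl//; last 3 first.
- apply/(measurable_restrictT _ _).1 => //; exact/measurable_EFinP/measurable_funTS.
- by move=> x _; rewrite erestrict_ge0// => z _; rewrite lee_fin.
- by rewrite lee_fin.
apply: eq_integral => x _; rewrite patchE indicE EFinM -muleA; congr (_ * _)%E.
by case: ifPn => _; rewrite ?mul1e ?mul0e.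
Qed.

(** True for indicators by [nuE], then for simple functions by linearity, then in general by
    monotone convergence. *)
Lemma ge0_integral_density (f : T -> \bar R) : measurable_fun setT f ->
  (forall x, 0 <= f x)%E -> (\int[nu]_x f x = \int[mu]_x (f x * (g x)%:E))%E.
Proof.
move=> mf f0; pose h := nnsfun_approx measurableT mf.
have hf x : EFin \o h^~ x @ \oo --> f x by apply: cvg_nnsfun_approx.
have nd x : nondecreasing_seq (fun n => (h n x)%:E).
  by move=> m n mn; rewrite lee_fin; exact/lefP/nd_nnsfun_approx.
transitivity (limn (fun n => \int[nu]_x (h n x)%:E))%E.
  rewrite -monotone_convergence//.
  - by apply: eq_integral => x _; apply/esym/cvg_lim => //; exact: hf.
  - by move=> n; exact/measurable_EFinP.
  - by move=> n x _; rewrite lee_fin.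
rewrite (_ : (fun n => _) = (fun n => \int[mu]_x ((h n x)%:E * (g x)%:E))%E); last first.
  by apply/funext => n; exact: step.
rewrite -monotone_convergence//.
- apply: eq_integral => x _; apply/cvg_lim => //.
  by apply: cvgeZr => //; exact: hf.
- by move=> n; apply: emeasurable_funM; exact/measurable_EFinP.
- by move=> n x _; rewrite mule_ge0// lee_fin.
- by move=> x _ m n mn; rewrite lee_wpmul2r ?lee_fin//; exact/lefP/nd_nnsfun_approx.
Qed.

End Density.

Section Beta_moments.
Context {R : realType}.
Local Notation mu := (@lebesgue_measure R).

Lemma integral_pospow a j :
  (\int[mu]_(y in `[0%R, +oo[) (y ^+ a * pospow j (1 - y))%:E)%E =
  (beta_fun (R := R) a.+1 j.+1)%:E.
Proof.
rewrite EFin_beta_fun /=.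
transitivity (\int[mu]_(y in `[0%R, 1%R]) (y ^+ a * (1 - y) ^+ j)%:E)%E; last first.
  rewrite [LHS]integral_mkcond; apply: eq_integral => y _.
  by rewrite !patchE; case: ifPn.
rewrite -integral_itv_bndo_bndc; last first.
  apply/measurable_EFinP; apply: measurable_funM; apply: measurable_funX => //.
  exact: measurable_funB.
rewrite integral_mkcond [RHS]integral_mkcond; apply: eq_integral => y _.
rewrite !patchE; case: ifPn => h1; case: ifPn => h2 //.
- move: h2; rewrite inE /= in_itv /= => /andP[_ y1].
  by rewrite /pospow subr_gt0 y1.
- move: h1 h2; rewrite inE notin_setE /= !in_itv /= andbT => y0.
  rewrite y0 /= => y1.
  by rewrite /pospow subr_gt0; case: ifP => //; rewrite mulr0.
- move: h1 h2; rewrite notin_setE inE /= !in_itv /= andbT => y0 /andP[y0' _].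
  by rewrite y0' in y0.
Qed.

Lemma eq_bint k (g h : R -> \bar R) : (forall y, 0 <= y -> g y = h y) ->
  bint k g = bint k h.
Proof.
move=> gh; apply: eq_integral => y; rewrite inE /= in_itv /= andbT => y0.
by rewrite gh.
Qed.

(** A variable of density [(k + 1) (1 - y)^k] has mean [1 / (k + 2)]. For [k = M - 2] this is the
    origin of the [1 / M] in the expectation. *)
Lemma bint_affine k (p q : R) : 0 <= p -> 0 <= q ->
  bint k.+1 (fun y => (p + q * y)%:E) = (p + q / k.+2%:R)%:E.
Proof.
move=> p0 q0; rewrite /bint.
pose F y : \bar R := ((p * k.+1%:R)%:E * (y ^+ 0 * pospow k (1 - y))%:E)%E.
pose G y : \bar R := ((q * k.+1%:R)%:E * (y ^+ 1 * pospow k (1 - y))%:E)%E.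
have mI : measurable (`[0, +oo[%classic : set (measurableTypeR R)) by exact: measurable_itv.
have mpw a : measurable_fun [set: R] (fun y => (y ^+ a * pospow k (1 - y))%:E).
  apply/measurable_EFinP; apply: measurable_funM => //.
  by apply: (measurableT_comp (measurable_pospow k)); exact: measurable_funB.
have hZ a (x : R) : 0 <= x -> (\int[mu]_(y in `[0%R, +oo[)
    (x%:E * (y ^+ a * pospow k (1 - y))%:E) = x%:E * (beta_fun (R := R) a.+1 k.+1)%:E)%E.
  move=> x0; rewrite ge0_integralZl ?integral_pospow//.
  - exact: (measurable_funTS (mpw a)).
  - by move=> y; rewrite /= in_itv/= andbT => y0; rewrite lee_fin mulr_ge0 ?exprn_ge0 ?pospow_ge0.
transitivity (\int[mu]_(y in `[0%R, +oo[) (F y + G y))%E.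
  apply: eq_integral => y _; rewrite /F /G -!EFinM -EFinD; congr (_%:E) => /=.
  by rewrite expr0 expr1; ring.
rewrite ge0_integralD//; last 4 first.
- by move=> y; rewrite /= in_itv/= andbT => y0; rewrite mule_ge0// lee_fin mulr_ge0 ?exprn_ge0 ?pospow_ge0.
- by apply: measurable_funTS; apply: emeasurable_funM; [exact: measurable_cst|exact: mpw].
- by move=> y; rewrite /= in_itv/= andbT => y0; rewrite mule_ge0// lee_fin mulr_ge0 ?exprn_ge0 ?pospow_ge0.
- by apply: measurable_funTS; apply: emeasurable_funM; [exact: measurable_cst|exact: mpw].
rewrite !hZ ?mulr_ge0//.
rewrite beta_fun1Sn beta_funSSnSm beta_fun1Sn -!EFinM -EFinD.
congr (_%:E); field.
by rewrite -[1 + _]/(1%:R + _) -!natrD !pnatr_eq0.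
Qed.

(** The absolute value makes the identity an admissible test function, nonnegative on the whole
    line; it is harmless because all factors [1 + c y] with [y >= 0] are nonnegative. The scalar [a]
    absorbs the factors already averaged. *)
Lemma beta_prod_norm k (s : seq R) (a : R) : all (fun c => 0 <= c) s -> 0 <= a ->
  beta_prod k.+1 s (fun z => (a * `|z|)%:E) =
  (a * \prod_(c <- s) (1 + c / k.+2%:R))%:E.
Proof.
elim: s a => [|c s IH] a /=; first by rewrite big_nil normr1.
move=> /andP[c0 s0] a0; rewrite big_cons mulrA -IH//; last first.
  by rewrite mulr_ge0// addr_ge0// divr_ge0.
congr (beta_prod _ _ _); apply/funext => z.
rewrite (@eq_bint _ _ (fun y => (a * `|z| + a * `|z| * c * y)%:E)); last first.
  move=> y y0; congr (_%:E); rewrite normrM (ger0_norm (_ : 0 <= 1 + c * y)); first by ring.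
  by rewrite addr_ge0// mulr_ge0.
by rewrite bint_affine ?mulr_ge0//; congr (_%:E); ring.
Qed.

Lemma beta_prod1 k (s : seq R) : beta_prod k.+1 s (fun=> 1%E) = 1%E.
Proof.
elim: s => //= c s IH; rewrite -[RHS]IH; congr (beta_prod _ _ _); apply/funext => z.
rewrite -[LHS](@eq_bint _ (fun y => (1 + 0 * y)%:E)); last by move=> y _; rewrite mul0r addr0.
by rewrite bint_affine// mul0r addr0.
Qed.

End Beta_moments.

(** * The law of a product of affine functions of independent variables *)

Section Independent_product.
Context {R : realType} {d : measure_display} {Om : measurableType d}.
Variables (Q : probability Om R) (I : finType) (D : {pred I}) (Y : I -> {RV Q >-> R}).
Hypothesis ind : mutually_independent D Y.
Variable c : I -> R.

Definition partial_prod (s : seq I) (w : Om) : R := \prod_(k <- s) (1 + c k * Y k w).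

Lemma measurable_partial_prod s : measurable_fun setT (partial_prod s).
Proof.
apply: measurable_prod => k _; apply: measurable_funD => //.
exact: measurable_funM.
Qed.

Let E (A : I -> set R) := \bigcap_(k in [set` D]) (Y k @^-1` A k).

Let mY k (B : set R) : measurable B -> measurable (Y k @^-1` B).
Proof.
by move=> mB; rewrite -[X in measurable X]setTI; apply: (measurable_funP (Y k)).
Qed.

Let mE A : (forall k, measurable (A k)) -> measurable (E A).
Proof.
move=> mA; apply: fin_bigcap_measurable; first exact: finite_finset.
by move=> k _; exact: mY.
Qed.

Let ET : E (fun=> setT) = setT.
Proof. by apply/seteqP; split => // w _ k _. Qed.

Let pair k s (w : Om) : measurableTypeR R * measurableTypeR R :=
  (partial_prod s w, Y k w).

Let mpair k s : measurable_fun setT (pair k s).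
Proof.
by apply: measurable_fun_pair; [exact: measurable_partial_prod|exact: (measurable_funP (Y k))].
Qed.

Let pprodRV s : {RV Q >-> measurableTypeR R} :=
  HB.pack (partial_prod s) (isMeasurableFun.Build _ _ Om (measurableTypeR R) (partial_prod s)
    (measurable_partial_prod s)).

Let YRV k : {RV Q >-> measurableTypeR R} :=
  HB.pack (Y k : Om -> R) (isMeasurableFun.Build _ _ Om (measurableTypeR R) (Y k)
    (measurable_funP (Y k))).

(** Since [A k] is the full set, the event on [Y k] can be stored there by replacing it with [A0];
    the assumption on [s] then applies to the enlarged family. *)
Let rect k s (B A0 : set R) A : uniq (k :: s) -> {subset k :: s <= D} ->
  (forall (B : set R) (A : I -> set R), measurable B ->
    (forall k, measurable (A k)) -> (forall k, k \in s -> A k = setT) ->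
    Q (partial_prod s @^-1` B `&` E A) =
    (Q (partial_prod s @^-1` B) * \prod_(k in D) Q (Y k @^-1` A k))%E) ->
  measurable B -> measurable A0 -> (forall k, measurable (A k)) ->
  (forall j, j \in k :: s -> A j = setT) ->
  Q (pair k s @^-1` (B `*` A0) `&` E A) =
  (Q (partial_prod s @^-1` B) * (Q (E A) * Q (Y k @^-1` A0)))%E.
Proof.
move=> /= /andP[ks us] sD IH mB mA0 mA AT.
have kD : k \in D by apply: sD; rewrite mem_head.
pose A' j := if j == k then A0 else A j.
have EA' : pair k s @^-1` (B `*` A0) `&` E A = partial_prod s @^-1` B `&` E A'.
  apply/seteqP; split => w.
    move=> [[/= Bw Aw] Ew]; split => // j jD; rewrite /A'.
    by case: eqP => [->//|_]; exact: Ew.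
  move=> [Bw Ew]; split.
    by split => //=; have := Ew k kD; rewrite /A' eqxx.
  move=> j jD; have := Ew j jD; rewrite /A'; case: eqP => [->|//].
  by rewrite /= AT ?mem_head.
rewrite EA' IH//; last 2 first.
- by move=> j; rewrite /A'; case: eqP.
- move=> j js; rewrite /A'; case: eqP => [jk|_]; first by rewrite -jk js in ks.
  by rewrite AT// inE js orbT.
congr (_ * _)%E; rewrite (ind mA) (bigD1 k)//= [in RHS](bigD1 k)//= /A' eqxx.
rewrite AT ?mem_head// preimage_setT probability_setT mul1e muleC; congr (_ * _)%E.
by apply: eq_bigr => j /andP[_ /negPf ->].
Qed.

(** Independence is given for rectangles only. It passes to products by adding one variable at a
    time: the law of the pair formed by a partial product and the next variable is determined by its
    values on rectangles, hence known on the preimage [S] of [B] under multiplication. *)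
Lemma partial_prod_indep s : uniq s -> {subset s <= D} ->
  forall (B : set R) (A : I -> set R), measurable B ->
  (forall k, measurable (A k)) -> (forall k, k \in s -> A k = setT) ->
  Q (partial_prod s @^-1` B `&` E A) =
  (Q (partial_prod s @^-1` B) * \prod_(k in D) Q (Y k @^-1` A k))%E.
Proof.
elim: s => [|k s IH] us sD B A mB mA AT.
  have [B1|B1] := pselect (B 1).
    rewrite (_ : _ @^-1` _ = setT) ?setTI ?probability_setT ?mul1e ?ind//.
    by apply/seteqP; split => // w _; rewrite /= /partial_prod big_nil.
  rewrite (_ : _ @^-1` _ = set0) ?set0I ?measure0 ?mul0e//.
  by apply/seteqP; split => // w; rewrite /= /partial_prod big_nil.
have {}IH := IH (subseq_uniq (subseq_cons s k) us)
  (fun j js => sD j (mem_behead (s := k :: s) js)).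
rewrite -(ind mA).
pose S := (fun p : measurableTypeR R * measurableTypeR R => (1 + c k * p.2) * p.1) @^-1` B.
have mS : measurable S.
  rewrite -[X in measurable X]setTI.
  suff mf : measurable_fun [set: measurableTypeR R * measurableTypeR R]
      (fun p => (1 + c k * p.2) * p.1) by exact: mf.
  apply: measurable_funM; last exact: measurable_fst.
  by apply: measurable_funD => //; apply: measurable_funM => //; exact: measurable_snd.
have SE : partial_prod (k :: s) @^-1` B = pair k s @^-1` S.
  by apply/seteqP; split => w; rewrite /S /= /partial_prod big_cons.
rewrite SE.
have eE : Q (E A) \is a fin_num by exact: fin_num_measure (mE mA).
have e0 : 0 <= fine (Q (E A)) by rewrite fine_ge0.
(* The law of the pair restricted to [E A], and that law multiplied by the probability of [E A].
   Both coincide on rectangles with the product of [n1] and [n2]. *)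
pose m1 : {measure set (measurableTypeR R * measurableTypeR R) -> \bar R} :=
  measure_function_pushforward__canonical__measure_function_Measure
    (mrestr Q (mE mA)) (mpair k s).
pose m2 : {measure set (measurableTypeR R * measurableTypeR R) -> \bar R} :=
  mscale (NngNum e0) (measure_function_pushforward__canonical__measure_function_Measure
    Q (mpair k s)).
pose n1 := distribution Q (pprodRV s).
pose n2 := mscale (NngNum e0) (distribution Q (YRV k)).
have m1E X : measurable X -> (n1 \x n2)%E X = m1 X.
  apply: product_measure_unique => B0 A0 mB0 mA0.
  rewrite [LHS](rect us sD IH mB0 mA0 mA AT).
  by rewrite -[in LHS](fineK eE).
have m2E X : measurable X -> (n1 \x n2)%E X = m2 X.
  apply: product_measure_unique => B0 A0 mB0 mA0.
  have := rect us sD IH mB0 mA0 (fun _ => measurableT) (fun _ _ => erefl).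
  rewrite ET setIT probability_setT mul1e => rE.
  rewrite -[LHS]/((fine (Q (E A)))%:E * Q (pair k s @^-1` (B0 `*` A0)))%E rE.
  by rewrite muleCA.
have := m1E S mS; rewrite (m2E S mS).
rewrite -[X in X = _ -> _]/((fine (Q (E A)))%:E * Q (pair k s @^-1` S))%E fineK//.
by rewrite muleC => ->.
Qed.

Lemma partial_prod_pair k s : uniq (k :: s) -> {subset k :: s <= D} ->
  forall X, measurable X ->
  (distribution Q (pprodRV s) \x distribution Q (YRV k))%E X = Q (pair k s @^-1` X).
Proof.
move=> us sD X mX.
pose m2 : {measure set (measurableTypeR R * measurableTypeR R) -> \bar R} :=
  measure_function_pushforward__canonical__measure_function_Measure Q (mpair k s).
apply: (@product_measure_unique _ _ _ _ _ _ _ m2) => // B0 A0 mB0 mA0.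
have IH := partial_prod_indep (subseq_uniq (subseq_cons s k) us)
  (fun j js => sD j (mem_behead (s := k :: s) js)).
have := rect us sD IH mB0 mA0 (fun _ => measurableT) (fun _ _ => erefl).
by rewrite ET setIT probability_setT mul1e.
Qed.

Variable n : nat.
Hypothesis densY : forall k, k \in D -> has_density (Y k) (beta1_density n.+2).

(** The density lives on []0, 1[] while [bint] integrates over [[0, +oo[]: the point 0 is negligible
    and [pospow] vanishes from 1 on. *)
Let integral_Y k (g : R -> \bar R) : k \in D -> measurable_fun setT g ->
  (forall y, 0 <= g y)%E -> (\int[distribution Q (YRV k)]_y g y = bint n.+1 g)%E.
Proof.
move=> kD mg g0.
have mbeta : measurable_fun [set: measurableTypeR R] (beta1_density (R := R) n.+2).
  apply: measurable_funM; last by apply: measurable_indic; exact: measurable_itv.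
  apply: measurable_funM => //; apply: measurable_funX; exact: measurable_funB.
have beta0 x : 0 <= beta1_density (R := R) n.+2 x.
  rewrite /beta1_density indicE mem_setE in_itv /=.
  have [x1|x1] := ltP x 1; last by rewrite andbF mulr0.
  by rewrite mulr_ge0// mulr_ge0// exprn_ge0// subr_ge0 ltW.
rewrite (@ge0_integral_density _ _ _ (@lebesgue_measure R) (distribution Q (YRV k)) _ mbeta beta0)//.
  rewrite /bint -integral_itv_obnd_cbnd; last first.
    apply: measurable_funTS; apply: emeasurable_funM => //.
    apply/measurable_EFinP; apply: measurable_funM => //.
    by apply: (measurableT_comp (measurable_pospow n)); exact: measurable_funB.
  rewrite [RHS]integral_mkcond; apply: eq_integral => y _.
  rewrite patchE /beta1_density indicE /pospow subr_gt0 !mem_setE !in_itv /= andbT.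
  rewrite subn1 subn2 /=; case: (0 < y) => /=; last by rewrite mulr0 mule0.
  by case: (y < 1); rewrite ?mulr1 ?mulr0.
by move=> A mA; exact: densY.
Qed.

Lemma integral_partial_prod s : uniq s -> {subset s <= D} ->
  forall f : R -> \bar R, measurable_fun setT f -> (forall x, 0 <= f x)%E ->
  (\int[Q]_w f (partial_prod s w) = beta_prod n.+1 [seq c k | k <- s] f)%E.
Proof.
elim: s => [|k s IH] us sD f mf f0 /=.
  under eq_integral do rewrite /partial_prod big_nil.
  by rewrite integral_cst// -[RHS]mule1; congr (_ * _)%E; exact: probability_setT.
have kD : k \in D by apply: sD; rewrite mem_head.
rewrite -IH; last 4 first.
- by case/andP: us.
- by move=> j js; apply: sD; rewrite inE js orbT.
- exact: measurable_bint_step.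
- by move=> x; exact: bint_ge0.
pose h (p : measurableTypeR R * measurableTypeR R) := f (p.1 * (1 + c k * p.2)).
have mh : measurable_fun setT h.
  apply: (measurableT_comp (mf : measurable_fun [set: measurableTypeR R] f)).
  apply: measurable_funM; first exact: measurable_fst.
  by apply: measurable_funD => //; apply: measurable_funM => //; exact: measurable_snd.
transitivity (\int[pushforward Q (pair k s)]_p h p)%E.
  rewrite (integral_pushforwardT Q (mpair k s) mh (fun p => f0 _)); apply: eq_integral => w _.
  by rewrite /h /= /partial_prod big_cons mulrC.
transitivity (\int[distribution Q (pprodRV s) \x distribution Q (YRV k)]_p h p)%E.
  by apply: eq_measure_integral => A mA _; exact: esym (partial_prod_pair us sD mA).
rewrite (@fubini_tonelli1 _ _ _ _ _ _ _ h)//; last by move=> p; exact: f0.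
have mF := measurable_bint_step n.+1 (c k) f0 mf.
rewrite (eq_integral (fun z : measurableTypeR R => bint n.+1 (fun y => f (z * (1 + c k * y))%R))); last first.
  move=> z _; rewrite /fubini_F (integral_Y kD (g := fun y => h (z, y)))//.
    exact: (measurableT_comp mh (measurable_pair1 z)).
  by move=> y; exact: f0.
apply: (@integral_pushforwardT _ _ Om (measurableTypeR R) R (partial_prod s) Q
  (fun z : R => bint n.+1 (fun y => f (z * (1 + c k * y)))) (measurable_partial_prod s) mF).
by move=> z; exact: bint_ge0.
Qed.

End Independent_product.

(** * The conditional law *)

Section Codes.

Lemma mem_column_codes p k n i j b :
  ((i, j, b) \in column_codes p k n) = (j == n) && (p <= i < p + k)%N.
Proof.
elim: k p => [|k IH] p; first by rewrite addn0 in_nil; case: (j == n) => //=; case: ltngtP.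
rewrite /= !inE IH !xpair_eqE addSnnS [in RHS]leq_eqVlt [p == i]eq_sym.
case: (j == n); rewrite ?andbF//= !andbT.
have [->|_] /= := eqVneq i p; last by [].
by rewrite ltnn -addSnnS leq_addr; case: b {IH}.
Qed.

Lemma mem_upper_codes n i j b : ((i, j, b) \in upper_codes n) = (i < j < n)%N.
Proof.
elim: n => [|n IH]; first by rewrite in_nil ltn0 andbF.
rewrite /= mem_cat IH mem_column_codes add0n leq0n /=.
case: (eqVneq j n) => [->|jn] /=; first by rewrite ltnn andbF ltnSn andbT.
by rewrite orbF ltnS (leq_eqVlt j n) (negPf jn).
Qed.

Lemma uniq_upper_codes n : uniq (upper_codes n).
Proof.
elim: n => //= n IH; rewrite cat_uniq IH /=; apply/andP; split.
  apply/hasPn => -[[i j] b]; rewrite mem_column_codes => /andP[/eqP -> _] /=.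
  by rewrite mem_upper_codes ltnn andbF.
have h k p : uniq (column_codes p k n).
  elim: k p => //= k IHk p.
  by rewrite !inE xpair_eqE eqxx /= !mem_column_codes ltnn !andbF IHk.
exact: h.
Qed.

Context {R : realType} {n : nat}.
Local Notation C := R[i].
Local Notation I := (nat * nat * bool)%type.
Local Notation a := #|{: upper_index n.+1}|.

Definition upper_code (k : 'I_(a + a)) : I :=
  let c (q : 'I_a) b := let p := val (enum_val q) in (val p.1, val p.2, b) in
  match fintype.split k with inl q => c q false | inr q => c q true end.

Definition upper_code_tuple : (a + a).-tuple I := [tuple upper_code k | k < a + a].

Lemma upper_code_inj : injective upper_code.
Proof.
have h (q q' : 'I_a) : (val (val (enum_val q)).1, val (val (enum_val q)).2) =
    (val (val (enum_val q')).1, val (val (enum_val q')).2) -> q = q'.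
  move=> [e1 e2]; apply: enum_val_inj; apply: val_inj.
  rewrite [LHS]surjective_pairing [RHS]surjective_pairing.
  by congr pair; apply: val_inj.
move=> k k'; rewrite /upper_code; case: split_ordP => q ->; case: split_ordP => q' -> // [] e1 e2.
  by congr (lshift _ _); apply: h; congr pair.
by congr (rshift _ _); apply: h; congr pair.
Qed.

Lemma uniq_upper_code_tuple : uniq upper_code_tuple.
Proof. by rewrite map_inj_uniq ?enum_uniq//; exact: upper_code_inj. Qed.

Lemma mem_upper_code_tuple i j b :
  ((i, j, b) \in upper_code_tuple) = (i < j < n.+1)%N.
Proof.
apply/mapP/idP => [[k _]|/andP[ij jn]].
  rewrite /upper_code; case: splitP => q _ [-> -> _];
    by rewrite (valP (enum_val q)) ltn_ord.
have in_ : (i < n.+1)%N by exact: ltn_trans ij jn.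
pose p : upper_index n.+1 := Sub (Ordinal in_, Ordinal jn) ij.
exists ((if b then @rshift a a else @lshift a a) (enum_rank p)); first by rewrite mem_enum.
rewrite /upper_code; case: b.
  by case: split_ordP => q /eqP; rewrite ?eq_rlshift// => /eqP/rshift_inj <-; rewrite enum_rankK.
by case: split_ordP => q /eqP; rewrite ?eq_lrshift// => /eqP/lshift_inj <-; rewrite enum_rankK.
Qed.

Definition upper_decode (x : upper_entries R n.+1) : I -> R :=
  fun c => nth 0 x (index c upper_code_tuple).

Lemma upper_decodeK x : map_tuple (upper_decode x) upper_code_tuple = x.
Proof.
apply: eq_from_tnth => k; rewrite tnth_map tnth_mktuple /upper_decode.
rewrite (_ : index _ _ = k) -?tnth_nth//.
rewrite -[X in index X _](_ : nth (upper_code k) upper_code_tuple k = _); last first.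
  by rewrite -tnth_nth tnth_mktuple.
by rewrite index_uniq ?uniq_upper_code_tuple// size_tuple.
Qed.

Lemma upper_decode_map (y : I -> R) i j b : (i < j < n.+1)%N ->
  upper_decode (map_tuple y upper_code_tuple) (i, j, b) = y (i, j, b).
Proof.
move=> h; rewrite /upper_decode /= (nth_map (0%N, 0%N, false)) ?nth_index// ?index_mem;
  by rewrite mem_upper_code_tuple.
Qed.

Lemma measurable_upper_decode c : measurable_fun setT (fun x => upper_decode x c).
Proof.
rewrite /upper_decode; have [h|h] := ltnP (index c upper_code_tuple) (a + a).
  apply: (eq_measurable_fun (fun x : upper_entries R n.+1 => tnth x (Ordinal h))).
    by move=> x _; rewrite (tnth_nth 0).
  exact: measurable_tnth.
apply: (eq_measurable_fun (fun _ : upper_entries R n.+1 => (0 : R)));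
  last exact: measurable_cst.
by move=> x _; rewrite nth_default// size_tuple.
Qed.

(** [lebesgue_upper] orders the coordinates by [enum_rank], real parts before imaginary parts, and
    [upper_codes] orders them by columns. Both list each code once, so one order can be permuted
    into the other. [F] may read only strictly upper coordinates, since [upper_decode] puts 0 at all
    others. *)
Lemma integral_lebesgue_upper (F : (I -> R) -> \bar R) :
  (forall y, 0 <= F y)%E -> mfunctional F ->
  (forall y y', (forall i j b, (i < j < n.+1)%N -> y (i, j, b) = y' (i, j, b)) -> F y = F y') ->
  (\int[lebesgue_upper R n.+1]_x F (upper_decode x) = itint (upper_codes n.+1) F (fun=> 0%R))%E.
Proof.
move=> F0 mF extF.
rewrite (@integral_lebesgue_tuple _ _ _ upper_code_tuple
  (fun x => F (upper_decode x)) (fun=> 0))//; last 2 first.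
- exact: uniq_upper_code_tuple.
- exact: (mF _ _ _ measurable_upper_decode).
rewrite (@eq_itint _ _ _ _ F); last by move=> y; apply: extF => i j b; exact: upper_decode_map.
apply: itint_perm => //; first by rewrite rev_uniq uniq_upper_code_tuple.
apply: uniq_perm; rewrite ?rev_uniq ?uniq_upper_code_tuple ?uniq_upper_codes//.
by move=> [[i j] b]; rewrite mem_rev mem_upper_code_tuple mem_upper_codes.
Qed.

Lemma schur_mx_upper_decode (lam : 'I_n.+1 -> C) x :
  schur_mx lam x = schur (fun k => lam (inord k)) n.+1 (upper_decode x).
Proof.
rewrite -{1}(upper_decodeK x); apply/matrixP => i j; rewrite !mxE inord_val.
case: eqVneq => // ij; case: ifP => ijlt; last by rewrite insubF.
rewrite (insubT (fun p : 'I_n.+1 * 'I_n.+1 => (p.1 < p.2)%N) (ijlt : ((i, j).1 < (i, j).2)%N)).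
cbn zeta; rewrite !tnth_map !tnth_ord_tuple /upper_code /entry.
case: split_ordP => q /eqP; rewrite ?eq_lrshift// => /eqP/lshift_inj <-.
case: split_ordP => q' /eqP; rewrite ?eq_rlshift// => /eqP/rshift_inj <-.
by rewrite enum_rankK.
Qed.

End Codes.

(** * The overlap under the conditional law *)

Section Conditional_overlap.
Context {R : realType}.
Local Notation C := R[i].

Lemma sqmod_normc (z : C) : sqmod z = modc z ^+ 2.
Proof. by case: z => a b; rewrite /= sqr_sqrtr// addr_ge0 ?sqr_ge0. Qed.

Lemma modc_ge0 (z : C) : 0 <= modc z.
Proof. by case: z => a b; exact: sqrtr_ge0. Qed.

Lemma tue_schur_densityE n M (T : 'M[C]_n) : tue_schur_density M T =
  (\prod_(i < n) \prod_(j < n | (i < j)%N) modc (T i i - T j j) ^+ 2) * tdens (M - n) T.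
Proof.
rewrite /tue_schur_density -mulrA; congr (_ * _).
by rewrite /tdens indicE /gram; case: asboolP => h;
  [rewrite mem_set// mulr1|rewrite memNset// mulr0].
Qed.

Context {n M : nat} {lam : 'I_n.+1 -> C}.
Hypotheses (lam_inj : injective lam) (lam_disk : forall k, modc (lam k) < 1).
Hypotheses (n0 : (0 < n)%N) (nM : (n.+1 <= M)%N).

(** The spectrum as a sequence. Past [n], [inord] falls back on the first index, so every term stays
    in the open disk. *)
Let lamn (k : nat) : C := lam (inord k).

Let lam1 k : sqmod (lamn k) < 1.
Proof. by rewrite sqmod_normc expr_lt1 ?modc_ge0 //; exact: lam_disk. Qed.

Let lam0 k : (0 < k <= n)%N -> lamn 0 != lamn k.
Proof.
move=> /andP[k0 kn]; apply/eqP => /lam_inj /(congr1 val) /=.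
by rewrite !inordK//= => k0'; rewrite -k0' in k0.
Qed.

Definition overlap_coefs : seq R := [seq overlap_coef (lamn 0) (lamn k) | k <- rev (iota 1 n)].

Context {d : measure_display} {Om : measurableType d} {P : probability Om R}.
Variables (U : Om -> 'M[C]_n.+1) (X : {RV P >-> upper_entries R n.+1}) (G : Om -> 'M[C]_n.+1).
Hypotheses (uU : forall w, U w \is unitarymx) (lawX : schur_law_given M lam X)
  (GE : forall w, G w = U w *m schur_mx lam (X w) *m (U w) ^t*).

Let V : R := \prod_(i < n.+1) \prod_(j < n.+1 | (i < j)%N) modc (lam i - lam j) ^+ 2.

Let V0 : 0 <= V.
Proof. by apply: prodr_ge0 => i _; apply: prodr_ge0 => j _; exact: sqr_ge0. Qed.

Let densE x : tue_schur_density M (schur_mx lam x) =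
  V * tdens (M - n.+1) (schur lamn n.+1 (upper_decode x)).
Proof.
rewrite tue_schur_densityE schur_mx_upper_decode; congr (_ * _).
apply: eq_bigr => i _; apply: eq_bigr => j _.
by rewrite !mxE !eqxx /lamn !inord_val.
Qed.

Lemma conditional_overlapE w : diag_overlap (G w) lam ord0 = left_overlap lamn n.+1 (upper_decode (X w)).
Proof.
rewrite /left_overlap; apply: (diag_overlapE (uU w) (GE w)); rewrite ?schur_mx_upper_decode//.
- by move=> i j ji; rewrite mxE gt_eqF//= ltnNge ltnW.
- by move=> i; rewrite mxE eqxx /lamn inord_val.
- rewrite -colE; apply/matrixP => i j; rewrite ord1 !mxE andbT /lamn.
  have [->|i0] := eqVneq i ord0; first by rewrite mulr1 inord_val.
  by rewrite ltn0 mulr0.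
- rewrite -[lam ord0]/(lam ord0) (_ : lam ord0 = lamn 0); last first.
    by congr lam; apply: val_inj; rewrite /= inordK.
  by apply: left_vec_eigen => // k /andP[k0 kn]; apply: lam0; rewrite k0.
- exact: left_vec0.
Qed.

Let mdec : forall c, measurable_fun setT (fun w => upper_decode (X w) c).
Proof. by move=> c; exact: (measurableT_comp (measurable_upper_decode c) (measurable_funP X)). Qed.

Lemma measurable_conditional_overlap :
  measurable_fun setT (fun w => diag_overlap (G w) lam ord0).
Proof.
under eq_fun do rewrite conditional_overlapE.
exact: measurable_left_overlap.
Qed.

Lemma integral_conditional_overlap (f : R -> \bar R) : measurable_fun setT f ->
  (forall x, 0 <= f x)%E ->
  (\int[P]_w f (diag_overlap (G w) lam ord0) = beta_prod (M - 1) overlap_coefs f)%E.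
Proof.
have [c hc] := lawX.
have [K K0 KE] := @itint_schur _ lamn lam1 n (M - n.+1) lam0.
pose D (x : upper_entries R n.+1) := tdens (M - n.+1) (schur lamn n.+1 (upper_decode x)).
have mD : measurable_fun setT D by exact: (measurable_tdens lam1 measurable_upper_decode).
have D0 x : 0 <= D x by exact: tdens_ge0.
(* The invariant [m + n] of the column induction: beta factors with parameter [M - 1], that is,
   density exponent [M - 2]. *)
have Mn : (M - n.+1 + n)%N = (M - 1)%N by lia.
have key (f' : R -> \bar R) : measurable_fun setT f' -> (forall x, 0 <= f' x)%E ->
  (\int[lebesgue_upper R n.+1]_x (f' (left_overlap lamn n.+1 (upper_decode x)) * (D x)%:E) =
   K * beta_prod (M - 1) overlap_coefs f')%E.
  move=> mf f0.
  rewrite (integral_lebesgue_upper (F := fun y => f' (left_overlap lamn n.+1 y) *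
      (tdens (M - n.+1) (schur lamn n.+1 y))%:E))%E; first by rewrite KE// Mn.
  - by move=> y; rewrite mule_ge0// lee_fin tdens_ge0.
  - exact: mfunctional_density.
  - by move=> y y' /(eq_schur lamn)[-> ll]; rewrite /left_overlap /left_vec ll.
have mg : measurable_fun setT (fun x => c * (V * D x)).
  by apply: measurable_funM => //; exact: measurable_funM.
have one : (beta_prod (M - 1) overlap_coefs (fun=> 1%E) = 1 :> \bar R)%E.
  have -> : (M - 1)%N = (M - 2).+1 by lia.
  exact: beta_prod1.
(* The normalizing constant is only given as a real number; a negative one would make the total mass
   nonpositive. *)
have c0 : 0 <= c.
  rewrite leNgt; apply/negP => c0.
  have : (distribution P X setT <= 0)%E.
    rewrite (hc setT measurableT) mule_le0_ge0 ?lee_fin ?(ltW c0)//.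
    by apply: integral_ge0 => x _; rewrite lee_fin densE mulr_ge0 ?tdens_ge0.
  by rewrite probability_setT lee_fin ler10.
have densX A : measurable A -> distribution P X A =
    (\int[lebesgue_upper R n.+1]_(x in A) (c * (V * D x))%:E)%E.
  move=> mA; rewrite hc// -ge0_integralZl//; last 2 first.
  - apply: measurable_funTS; apply/measurable_EFinP.
    apply: (eq_measurable_fun (fun x : upper_entries R n.+1 => V * D x)); first by move=> x _; rewrite densE.
    exact: measurable_funM.
  - by move=> x _; rewrite lee_fin densE mulr_ge0 ?tdens_ge0.
  by apply: eq_integral => x _; rewrite densE.
have hP (f' : R -> \bar R) : measurable_fun setT f' -> (forall x, 0 <= f' x)%E ->
  (\int[P]_w f' (diag_overlap (G w) lam ord0) = (c * V)%:E * K * beta_prod (M - 1) overlap_coefs f')%E.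
  move=> mf f0.
  under eq_integral do rewrite conditional_overlapE.
  have mov : measurable_fun [set: upper_entries R n.+1] (fun x => left_overlap lamn n.+1 (upper_decode x)).
    by apply: measurable_left_overlap; exact: measurable_upper_decode.
  have mfov := measurableT_comp mf mov.
  rewrite -(@integral_pushforwardT _ _ _ _ _ X P _ (measurable_funP X) mfov); last by move=> x; exact: f0.
  have g0 x : 0 <= c * (V * D x) by rewrite mulr_ge0// mulr_ge0.
  rewrite (ge0_integral_density mg g0 densX mfov); last by move=> x; exact: f0.
  rewrite -muleA -key// -ge0_integralZl//; last 3 first.
  - by apply: emeasurable_funM => //; exact/measurable_EFinP.
  - by move=> x _; rewrite mule_ge0// lee_fin.
  - by rewrite lee_fin mulr_ge0.
  by apply: eq_integral => x _; rewrite muleCA -EFinM mulrA.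
(* The test function 1 evaluates the product of all constants, which also excludes a zero or
   infinite [K]. *)
have cVK : ((c * V)%:E * K = 1)%E.
  have := hP (fun=> 1%E) (measurable_cst _) (fun=> lee01).
  by rewrite one mule1 => <-; rewrite integral_cst// [X in (_ * X)%E](probability_setT P) mule1.
by move=> mf f0; rewrite hP// cVK mul1e.
Qed.

End Conditional_overlap.

Section Reindex.
Context {R : realType} {n : nat}.

(** Reversed to follow the order in which the columns are removed, so that the overlap and the
    product of the [Y k] lead to the same list of coefficients. *)
Definition tail_indices : seq 'I_n.+1 := rev [seq lift ord0 j | j <- enum 'I_n].

Lemma tail_indices_uniq : uniq tail_indices.
Proof. by rewrite rev_uniq map_inj_uniq ?enum_uniq//; exact: lift_inj. Qed.

Lemma sub_tail_indices : {subset tail_indices <= [pred k | k != ord0]}.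
Proof. by move=> k; rewrite mem_rev => /mapP[j _ ->]; rewrite inE eq_sym neq_lift. Qed.

Lemma prod_tail_indices (F : 'I_n.+1 -> R) :
  \prod_(k | k != ord0) F k = \prod_(k <- tail_indices) F k.
Proof.
rewrite [LHS]big_mkcond big_ord_recl/= mul1r.
rewrite (perm_big [seq lift ord0 j | j <- enum 'I_n]) ?perm_rev//.
by rewrite big_map big_enum.
Qed.

Lemma overlap_coefsE (lam : 'I_n.+1 -> R[i]) :
  @overlap_coefs R n lam = [seq overlap_coef (lam ord0) (lam k) | k <- tail_indices].
Proof.
rewrite /overlap_coefs /tail_indices !map_rev -map_comp; congr rev.
rewrite -(addn0 1%N) iotaDl -val_enum_ord -!map_comp; apply: eq_map => j /=.
congr (overlap_coef (lam _) (lam _)); apply: val_inj; rewrite /= inordK//.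
by rewrite ltnS; exact: ltn_ord.
Qed.

End Reindex.

Theorem theorem3p5 (R : realType) (N M : nat) (hN : (2 <= N)%N) (hNM : (N <= M)%N)
    (lam : 'I_N -> R[i])
    (lam_inj : injective lam) (lam_disk : forall k, modc (lam k) < 1)
    (d : measure_display) (Om : measurableType d) (P : probability Om R)
    (G : Om -> 'M[R[i]]_N) (hG : tue_given_spectrum P M lam G) :
  let i1 : 'I_N := Ordinal (ltnW hN) in
  let ov := fun w => diag_overlap (G w) lam i1 in
  let coef := fun k : 'I_N =>
    (1 - modc (lam i1) ^+ 2) * (1 - modc (lam k) ^+ 2) /
      modc (lam i1 - lam k) ^+ 2 in
  (forall (d' : measure_display) (Om' : measurableType d')
      (Q : probability Om' R) (Y : 'I_N -> {RV Q >-> R}),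
    mutually_independent [pred k | k != i1] Y ->
    (forall k, k != i1 -> has_density (Y k) (beta1_density M)) ->
    eq_in_law P Q ov (fun w => \prod_(k < N | k != i1) (1 + coef k * Y k w)))
  /\
  ('E_P[ov])%E = (\prod_(k < N | k != i1) (1 + coef k / M%:R))%:E.
Proof.
case: N => [//|n] in hN hNM lam lam_inj lam_disk G hG *.
have -> : Ordinal (ltnW hN) = ord0 by exact: val_inj.
move=> i1 ov coef.
have coefE k : coef k = overlap_coef (lam i1) (lam k).
  by rewrite /overlap_coef !sqmod_normc.
have [U [X [uU lawX GE]]] := hG.
have mov : measurable_fun setT ov := measurable_conditional_overlap lam_inj uU GE.
have ME : M = (M - 2).+2 by rewrite -addn2 subnK// (leq_trans hN).
have M1 : (M - 1)%N = (M - 2).+1 by rewrite [in LHS]ME subn1.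
have ovP (f : R -> \bar R) : measurable_fun setT f -> (forall x, 0 <= f x)%E ->
    (\int[P]_w f (ov w) = beta_prod (M - 2).+1 [seq coef k | k <- tail_indices] f)%E.
  move=> mf f0; rewrite (eq_map coefE) -overlap_coefsE -M1.
  exact: (integral_conditional_overlap lam_inj lam_disk (hN : (0 < n)%N) hNM uU lawX GE mf f0).
have indic_ge0 (A : set R) x : (0 <= (\1_A x : R)%:E)%E by rewrite lee_fin.
split.
  move=> d' Om' Q Y indY densY.
  have prodE : (fun w => \prod_(k | k != i1) (1 + coef k * Y k w)) =
      partial_prod Y coef tail_indices.
    by apply/funext => w; rewrite prod_tail_indices.
  have mprod := measurable_partial_prod Y coef tail_indices.
  rewrite prodE; split=> // A mA.
  have probE d0 (T : measurableType d0) (Q0 : probability T R) (Z : T -> R) :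
      measurable_fun setT Z -> Q0 (Z @^-1` A) = (\int[Q0]_w (\1_A (Z w))%:E)%E.
    move=> mZ; rewrite -[Z @^-1` A]setIT -integral_indic//.
    by rewrite -[_ @^-1` _]setTI; exact: mZ.
  rewrite !probE// (ovP (fun z => (\1_A z)%:E)); [|exact: measurable_indic_EFin|exact: indic_ge0].
  rewrite (@integral_partial_prod _ _ _ Q _ [pred k | k != i1] Y indY coef (M - 2)
    _ _ _ _ (fun z => (\1_A z)%:E))//.
  - by rewrite -ME.
  - exact: tail_indices_uniq.
  - exact: sub_tail_indices.
  - exact: measurable_indic_EFin.
have ov_ge0 w : 0 <= ov w.
  rewrite /ov (conditional_overlapE lam_inj uU GE).
  by apply: sumr_ge0 => j _; exact: sqmod_ge0.
rewrite unlock prod_tail_indices.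
(* The overlap is nonnegative, so its mean is the integral of its absolute value, in the form with
   scalar [a = 1] of [beta_prod_norm]. *)
transitivity (\int[P]_w ((1 * `|ov w|)%:E))%E.
  by apply: eq_integral => w _; rewrite mul1r ger0_norm.
rewrite (ovP (fun z => (1 * `|z|)%:E)); first last.
- by move=> x; rewrite lee_fin mul1r.
- by apply/measurable_EFinP; apply: measurable_funM => //; exact: measurableT_comp.
rewrite beta_prod_norm//; last first.
  apply/allP => x /mapP[k _ ->].
  by rewrite divr_ge0 ?sqr_ge0// mulr_ge0// subr_ge0 expr_le1 ?modc_ge0// ltW.
by rewrite mul1r big_map -ME.
Qed.
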